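(* Let $k_n\in\{0,\dots,n-1\}$ with $\pi_n:=k_n/n\to\pi\in[0,1]$, and consider shuffled binary randomized response with $e^{\varepsilon_0(n)}=n^{\alpha}$, $\alpha\in(0,1)$. Let $P_n:=T_{n,k_n}$, $Q_n:=T_{n,k_n+1}$ and $\Lambda_{n,k_n}:=\log(dQ_n/dP_n)$. Write $$\delta_n:=\frac1{1+n^{\alpha}},\qquad v_n:=n\delta_n(1-\delta_n),\qquad \Delta_n:=1-2\delta_n,\qquad h_n:=\frac{\Delta_n}{\sqrt{v_n}}.$$ Then $h_n\sim n^{(\alpha-1)/2}\to0$, and $$\frac{\Lambda_{n,k_n}+\frac12h_n^2}{h_n}\Longrightarrow N(0,1)\quad\text{under }P_n,\qquad\frac{\Lambda_{n,k_n}-\frac12h_n^2}{h_n}\Longrightarrow N(0,1)\quad\text{under }Q_n.$$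
   Context: Binary randomized response with level $\varepsilon_0(n)>0$: a user with input bit $x$ outputs $1-x$ with probability $\delta_n=1/(1+e^{\varepsilon_0(n)})$ and $x$ with probability $1-\delta_n$, independently across the $n$ users (here $n\ge2$ so that $\varepsilon_0(n)>0$). $T_{n,k}$ is the law of the shuffled transcript (the multiset of outputs) when the dataset has exactly $k$ ones and $n-k$ zeros; equivalently, the law of the number of output ones, which is the sum of independent $\mathrm{Bin}(n-k,\delta_n)$ and $\mathrm{Bin}(k,1-\delta_n)$ variables. $\Longrightarrow$ denotes convergence in distribution as $n\to\infty$, and $\Lambda_{n,k_n}$ is regarded as a random variable evaluated at the transcript. *)

(* Defs.v *)
From HB Require Import structures.
From mathcomp Require Import all_boot all_order all_algebra.
From mathcomp Require Import perm finmap multiset.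
From mathcomp Require Import all_classical all_reals all_analysis.

Set Implicit Arguments.
Unset Strict Implicit.
Unset Printing Implicit Defensive.

Import Order.TTheory GRing.Theory Num.Theory.
Import numFieldNormedType.Exports.

Local Open Scope classical_set_scope.
Local Open Scope ring_scope.

(* The shuffler releases the multiset of the users' output bits.  Transcripts
   carry the discrete sigma-algebra, so every statistic is measurable. *)
Definition transcript : Type := {mset bool}%mset.

HB.instance Definition _ := Choice.on transcript.
HB.instance Definition _ := isPointed.Build transcript mset0.
HB.instance Definition _ := @isMeasurable.Build default_measure_display
  transcript discrete_measurable discrete_measurable0
  discrete_measurableC discrete_measurableU.

Section randomized_response.
Context {R : realType}.
Implicit Types (eps : R) (n k : nat).

Definition flip_prob eps : R := (1 + expR eps)^-1.

Definition rr_pmf eps (x y : bool) : R :=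
  if y == x then 1 - flip_prob eps else flip_prob eps.

Definition rr_joint_pmf eps n (x y : n.-tuple bool) : R :=
  \prod_(i < n) rr_pmf eps (tnth x i) (tnth y i).

(* Law of the multiset of outputs when user [i] independently randomizes [x_i]. *)
Definition shuffled_rr eps n (x : n.-tuple bool) (A : set transcript) : \bar R :=
  (\sum_(y : n.-tuple bool)
     (rr_joint_pmf eps x y)%:E * \d_(seq_mset y : transcript) A)%E.

Lemma flip_prob01 eps : 0 <= flip_prob eps <= 1.
Proof.
have e0 := expR_gt0 eps.
by rewrite invr_ge0 invf_le1 ?addr_gt0// lerDl addr_ge0 ?ltW.
Qed.

Lemma rr_pmf_ge0 eps x y : 0 <= rr_pmf eps x y.
Proof.
by have /andP[? ?] := flip_prob01 eps; rewrite /rr_pmf; case: ifP; rewrite ?subr_ge0.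
Qed.

Lemma rr_joint_pmf_ge0 eps n (x y : n.-tuple bool) : 0 <= rr_joint_pmf eps x y.
Proof. by apply: prodr_ge0 => i _; exact: rr_pmf_ge0. Qed.

Lemma rr_joint_pmf_sum1 eps n (x : n.-tuple bool) :
  \sum_(y : n.-tuple bool) rr_joint_pmf eps x y = 1.
Proof.
pose G (f : {ffun 'I_n -> bool}) := [tuple f i | i < n].
have Gbij : bijective G.
  exists (fun y : n.-tuple bool => [ffun i => tnth y i]) => [f|y].
    by apply/ffunP => i; rewrite ffunE tnth_mktuple.
  by apply: eq_from_tnth => i; rewrite tnth_mktuple ffunE.
rewrite (reindex G); last exact: onW_bij.
transitivity (\sum_(f : {ffun 'I_n -> bool}) \prod_i rr_pmf eps (tnth x i) (f i)).
  by apply: eq_bigr => f _; apply: eq_bigr => i _; rewrite tnth_mktuple.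
rewrite -(bigA_distr_bigA (fun i b => rr_pmf eps (tnth x i) b)) big1// => i _.
by rewrite big_bool /rr_pmf; case: (tnth x i) => /=; rewrite ?subrK// addrC subrK.
Qed.

Section shuffled_rr_probability.
Context (eps : R) (n : nat) (x : n.-tuple bool).
Local Open Scope ereal_scope.

Let T0 : shuffled_rr eps x set0 = 0.
Proof. by rewrite /shuffled_rr big1// => y _; rewrite measure0 mule0. Qed.

Let T_ge0 A : 0 <= shuffled_rr eps x A.
Proof.
by apply: sume_ge0 => y _; rewrite mule_ge0// lee_fin rr_joint_pmf_ge0.
Qed.

Let T_sigma_additive : semi_sigma_additive (shuffled_rr eps x).
Proof.
move=> F mF tF mUF; rewrite /shuffled_rr.
under eq_fun do rewrite exchange_big/=.
apply: cvg_nnesum => y _.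
  by near=> m; apply: sume_ge0 => i _; rewrite mule_ge0// lee_fin rr_joint_pmf_ge0.
pose w : {nonneg R} := NngNum (rr_joint_pmf_ge0 eps x y).
exact: (@measure_semi_sigma_additive _ _ _ (mscale w (\d_(seq_mset y : transcript)))).
Unshelve. all: by end_near. Qed.

HB.instance Definition _ := isMeasure.Build _ _ _ (shuffled_rr eps x)
  T0 T_ge0 T_sigma_additive.

Let T_setT : shuffled_rr eps x [set: _] = 1.
Proof.
rewrite /shuffled_rr; under eq_bigr do rewrite diracT mule1.
by rewrite sumEFin rr_joint_pmf_sum1.
Qed.

HB.instance Definition _ :=
  Measure_isProbability.Build _ _ R (shuffled_rr eps x) T_setT.

End shuffled_rr_probability.

(* [k] ones followed by [n - k] zeros; by [shuffled_rr_count] the choice of the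
   dataset with [k] ones is immaterial. *)
Definition dataset n k : n.-tuple bool := [tuple (i < k)%N | i < n].

Definition rr_law eps n k : probability transcript R :=
  shuffled_rr eps (dataset n k).

Lemma shuffled_rr_perm eps n (x x' : n.-tuple bool) :
  perm_eq x x' -> shuffled_rr eps x = shuffled_rr eps x'.
Proof.
move=> /tuple_permP[s xs]; apply/funext => A; rewrite /shuffled_rr.
pose G (y : n.-tuple bool) := [tuple tnth y (s i) | i < n].
have Gbij : bijective G.
  exists (fun y : n.-tuple bool => [tuple tnth y ((s^-1)%g i) | i < n]) => y;
    by apply: eq_from_tnth => i; rewrite !tnth_mktuple ?permK ?permKV.
rewrite (reindex G); last exact: onW_bij.
apply: eq_bigr => y _.
have -> : seq_mset (G y) = seq_mset y.
  by apply/eq_seq_msetP/tuple_permP; exists s.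
congr (_ * _)%E.
  congr (_%:E); rewrite /rr_joint_pmf [RHS](reindex_inj (@perm_inj _ s)).
  apply: eq_bigr => i _; rewrite tnth_mktuple; congr rr_pmf.
  by rewrite (val_inj xs : x = [tuple tnth x' (s i) | i < n]) tnth_mktuple.
Qed.

Lemma shuffled_rr_count eps n k (x : n.-tuple bool) :
  count_mem true x = k -> shuffled_rr eps x = rr_law eps n k.
Proof.
move=> xk; apply: shuffled_rr_perm.
have cT (k' m : nat) : (k' <= m)%N ->
    count_mem true [seq (i < k')%N | i <- iota 0 m] = k'.
  move=> km; rewrite count_map -(subnKC km) iotaD count_cat add0n.
  rewrite (eq_in_count (a2 := predT)) => [|i]; last first.
    by rewrite mem_iota add0n /= => ->.
  rewrite count_predT size_iota (eq_in_count (a2 := pred0)) ?count_pred0 ?addn0//.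
  by move=> i; rewrite mem_iota /= => /andP[ki _]; rewrite ltnNge ki.
have kn : (k <= n)%N by rewrite -xk -{2}(size_tuple x) count_size.
have dE : tval (dataset n k) = [seq (i < k)%N | i <- iota 0 n].
  by rewrite -val_enum_ord -map_comp.
have dk : count_mem true (dataset n k) = k by rewrite dE cT.
have cF (y : n.-tuple bool) : count_mem false y = (n - count_mem true y)%N.
  have := count_predC (pred1 true) y; rewrite size_tuple => /(congr1 (subn^~ (count_mem true y))) <-.
  rewrite addKn.
  by apply: eq_count => -[].
apply/allP => -[] _; apply/eqP; first by rewrite [LHS]xk [RHS]dk.
by rewrite [LHS]cF [RHS]cF xk dk.
Qed.

End randomized_response.

Local Open Scope charge_scope.

(* The derivative is only determined [P]-almost everywhere; both laws of interest
   charge exactly the multisets of size [n], where it is the ratio of masses. *)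
Definition log_likelihood_ratio {R : realType} d (T : measurableType d)
    (P Q : probability T R) (z : T) : R :=
  ln (fine (('d (charge_of_finite_measure Q) '/d P) z)).

Lemma measurable_transcript {R : realType} (f : transcript -> R) :
  measurable_fun setT f.
Proof. by []. Qed.

Definition transcript_rv {R : realType} (f : transcript -> R) :
  {mfun transcript >-> R} := mfun_Sub (mem_set (measurable_transcript f)).

(* Convergence in distribution: the distribution functions converge at every
   continuity point of the distribution function of the limit. *)
Definition cvg_in_distribution {R : realType} d (T : measurableType d)
    (P : nat -> probability T R) (X : forall n, {RV (P n) >-> R})
    (mu : probability (measurableTypeR R) R) : Prop :=
  forall t : R, {for t, continuous (fun r : R => mu `]-oo, r]%classic)} ->
    cdf (X n) t @[n --> \oo] --> mu `]-oo, t]%classic.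

(* Main.v *)
Require Import Defs.
From HB Require Import structures.
From mathcomp Require Import all_boot all_order all_algebra.
From mathcomp Require Import finmap multiset.
From mathcomp Require Import all_classical all_reals all_analysis.
From mathcomp Require Import measurable_realfun ring lra.
Import Order.TTheory GRing.Theory Num.Theory.
Import numFieldNormedType.Exports.
Local Open Scope classical_set_scope.
Local Open Scope ring_scope.

Set Implicit Arguments.
Unset Strict Implicit.
Unset Printing Implicit Defensive.

(* The number of output ones has generating function
   G = (1 - d + d X)^a (d + (1 - d) X)^b.  Its coefficients w_j are log-concave,
   and the first-order differential equation of G is a three-term recurrence for
   them.  Eliminating one neighbour of w_j from the recurrence by log-concavity
   bounds w_{j+1} / w_j from both sides by 1 - (j - mean) / variance up to a term
   O(1 / variance), uniformly for j within a bounded number of standard deviations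
   of the mean.  These ratio bounds are used twice:
   - multiplied along j, they compare w_j with the normal density; together with
     Chebyshev's inequality this is the central limit theorem;
   - applied to the n - 1 users common to both datasets, they give
     Lambda = h x + O(h^2) at j = mean + x sqrt v, so that Lambda / h is
     asymptotically the standardized count, and the terms h / 2 vanish. *)

(** * The generating function of the number of ones *)

(** The flip probability varies with [n] and tends to 0, so the counts form a triangular array and
    the variance is the only large parameter. The constants therefore depend only on the window
    width [K] and on the inverse standard deviation [tau]. The recurrence links three neighbours and
    alone gives no ratio. Log-concavity turns it into an inequality between two neighbours, and
    completing the square there loses only a relative [O(tau ^+ 2)] inside a window. A window
    contains at most [2 * K / tau] steps, so a loss of order [tau ^+ 2] per step adds up to order
    [tau]. Comparisons with the normal law are cross-multiplied between two points, so the
    normalizing constant of the weights cancels; it is recovered at the end from the total mass of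
    the window. A zero and a one have the same output variance [d * (1 - d)]. Hence P and Q share
    one scale, and their means differ by [1 - 2 * d], that is by [h] in standardized units. One
    estimate of the statistic, centred at the mean of P, thus serves both laws. *)

(* The two-index form passes to products with affine factors even in the presence
   of zero coefficients, unlike [w j * w j.+2 <= w j.+1 ^+ 2]. *)
Definition log_concave {R : numDomainType} (w : nat -> R) : Prop :=
  forall i j, (i <= j)%N -> w i * w j.+2 <= w i.+1 * w j.+1.

Section generating_function.
Context {R : realFieldType}.
Implicit Types (d : R) (p : {poly R}) (a b : nat).

Lemma coef_affine_mul (c e : R) p j :
  ((c%:P + e *: 'X) * p)`_j = c * p`_j + (if j is i.+1 then e * p`_i else 0).
Proof.
rewrite mulrDl coefD coefCM -scalerAl coefZ coefXM.
by case: j => [|i] //=; rewrite mulr0.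
Qed.

Lemma log_concave_affine_mul (c e : R) p : 0 <= c -> 0 <= e ->
  (forall j, 0 <= p`_j) -> log_concave (fun j => p`_j) ->
  log_concave (fun j => ((c%:P + e *: 'X) * p)`_j).
Proof.
move=> c0 e0 p0 lcp i j ij; rewrite !coef_affine_mul.
have cc : 0 <= c * c by exact: mulr_ge0.
have ee : 0 <= e * e by exact: mulr_ge0.
have ce : 0 <= c * e by exact: mulr_ge0.
have H1 := lcp _ _ ij.
case: i ij H1 => [|i] ij H1.
  have := ler_wpM2l cc H1.
  have : 0 <= (c * e) * (p`_1 * p`_j) by rewrite mulr_ge0// mulr_ge0.
  have : 0 <= (e * e) * (p`_0 * p`_j) by rewrite mulr_ge0// mulr_ge0.
  nra.
case: j ij H1 => [//|j]; rewrite ltnS => ij H1.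
have H2 := lcp _ _ ij.
(* Once the term common to both sides cancels, the [c * e] part needs this exchange by two
   positions. It is log-concavity used twice; for [i = j] the second use degenerates to
   commutativity. *)
have H3 : p`_i * p`_j.+3 <= p`_i.+2 * p`_j.+1.
  apply: (le_trans (lcp i j.+1 (leqW ij))).
  move: ij; rewrite leq_eqVlt => /predU1P[->|ij]; first by rewrite mulrC.
  exact: lcp.
have := ler_wpM2l cc H1.
have := ler_wpM2l ee H2.
have := ler_wpM2l ce H3.
nra.
Qed.

(* Generating function of the number of output ones for [a] zeros and [b] ones. *)
Definition rr_gf d a b : {poly R} :=
  ((1 - d)%:P + d *: 'X) ^+ a * (d%:P + (1 - d) *: 'X) ^+ b.

Lemma rr_gfSl d a b : rr_gf d a.+1 b = ((1 - d)%:P + d *: 'X) * rr_gf d a b.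
Proof. by rewrite /rr_gf exprS mulrA. Qed.

Lemma rr_gfSr d a b : rr_gf d a b.+1 = (d%:P + (1 - d) *: 'X) * rr_gf d a b.
Proof. by rewrite /rr_gf exprS mulrCA. Qed.

Lemma rr_gf00 d : rr_gf d 0 0 = 1.
Proof. by rewrite /rr_gf !expr0 mulr1. Qed.

Lemma rr_gf_ind d (K : nat -> {poly R} -> Prop) : K 0%N 1 ->
  (forall n p, K n p -> K n.+1 (((1 - d)%:P + d *: 'X) * p)) ->
  (forall n p, K n p -> K n.+1 ((d%:P + (1 - d) *: 'X) * p)) ->
  forall a b, K (a + b)%N (rr_gf d a b).
Proof.
move=> K0 Kl Kr; elim=> [|a IHa] b; last by rewrite rr_gfSl addSn; exact: Kl.
elim: b => [|b IHb]; first by rewrite rr_gf00.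
by rewrite rr_gfSr addnS; exact: Kr.
Qed.

Lemma coef_rr_gf_gt0 d a b j : 0 < d < 1 -> (j <= a + b)%N -> 0 < (rr_gf d a b)`_j.
Proof.
move=> /andP[d0 d1]; have d1' : 0 < 1 - d by rewrite subr_gt0.
(* Vanishing above [n] is carried along because the new top coefficient involves the coefficient of
   [p] just past its degree. *)
have step (c e : R) : 0 < c -> 0 < e -> forall n p,
    (forall j, (n < j)%N -> p`_j = 0) /\ (forall j, (j <= n)%N -> 0 < p`_j) ->
    (forall j, (n.+1 < j)%N -> ((c%:P + e *: 'X) * p)`_j = 0) /\
    (forall j, (j <= n.+1)%N -> 0 < ((c%:P + e *: 'X) * p)`_j).
  move=> c0 e0 n p [pz pp]; split=> -[|i] ni //; rewrite coef_affine_mul.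
  - by rewrite !pz// ?mulr0 ?addr0// ltnW.
  - by rewrite addr0 mulr_gt0// pp.
  - rewrite ltr_wpDl// ?mulr_gt0 ?pp//.
    case: (leqP i.+1 n) => h; first by rewrite mulr_ge0 ?ltW// pp.
    by rewrite pz// mulr0.
have := @rr_gf_ind d (fun n p => (forall j, (n < j)%N -> p`_j = 0) /\
  (forall j, (j <= n)%N -> 0 < p`_j)).
move=> /(_ _ (step _ _ d1' d0) (step _ _ d0 d1') a b) [|_]; last exact.
by split=> -[|i] //; rewrite coef1 ?ltr01.
Qed.

Lemma coef_rr_gf_eq0 d a b j : (a + b < j)%N -> (rr_gf d a b)`_j = 0.
Proof.
pose K n p := forall j, (n < j)%N -> p`_j = 0 :> R.
have step (c e : R) n p : K n p -> K n.+1 ((c%:P + e *: 'X) * p).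
  move=> pz [|i]// ni; rewrite coef_affine_mul !pz ?mulr0 ?addr0//.
  exact: ltnW.
apply: (@rr_gf_ind d K) => //; try by move=> n p; exact: step.
by move=> [|i]//; rewrite coef1.
Qed.

Lemma coef_rr_gf_ge0 d a b j : 0 < d < 1 -> 0 <= (rr_gf d a b)`_j.
Proof.
move=> d01; case: (leqP j (a + b)) => h; first exact/ltW/coef_rr_gf_gt0.
by rewrite coef_rr_gf_eq0.
Qed.

Lemma log_concave_rr_gf d a b : 0 < d < 1 ->
  log_concave (fun j => (rr_gf d a b)`_j).
Proof.
move=> d01; have /andP[d0 d1] := d01.
have d1' : 0 <= 1 - d by rewrite subr_ge0 ltW.
elim: a => [|a IHa] in b *.
  elim: b => [|b IHb].
    by move=> i j ij; rewrite rr_gf00 !coef1/= !mulr0.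
  rewrite rr_gfSr; apply: log_concave_affine_mul => //; first exact: ltW.
  by move=> j; exact: coef_rr_gf_ge0.
rewrite rr_gfSl; apply: log_concave_affine_mul => //; first exact: ltW.
by move=> j; exact: coef_rr_gf_ge0.
Qed.

Lemma size_rr_gf d a b : (size (rr_gf d a b) <= (a + b).+1)%N.
Proof. by apply/leq_sizeP => j; exact: coef_rr_gf_eq0. Qed.

(** The logarithmic derivative of a product of powers of two affine factors, with denominators
    cleared. *)
Lemma rr_gf_ode d a b :
  ((1 - d)%:P + d *: 'X) * (d%:P + (1 - d) *: 'X) * (rr_gf d a b)^`() =
  ((a%:R * d) *: (d%:P + (1 - d) *: 'X) +
   (b%:R * (1 - d)) *: ((1 - d)%:P + d *: 'X)) * rr_gf d a b.
Proof.
have dL (c e : R) : (c%:P + e *: 'X)^`() = e%:P.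
  by rewrite derivD derivC derivZ derivX add0r alg_polyC.
have step (c e : R) n : (c%:P + e *: 'X) * ((c%:P + e *: 'X) ^+ n)^`() =
    (n%:R * e) *: (c%:P + e *: 'X) ^+ n.
  rewrite deriv_exp dL; case: n => [|n]; first by rewrite mulr0n mulr0 mul0r scale0r.
  rewrite -!mul_polyC !polyCM !rmorph_nat exprS -[X in _ * X]mulr_natr; ring.
rewrite /rr_gf derivM mulrDr.
set L1 := (1 - d)%:P + d *: 'X; set L2 := d%:P + (1 - d) *: 'X.
have -> : L1 * L2 * ((L1 ^+ a)^`() * L2 ^+ b) = L2 * (L1 * (L1 ^+ a)^`()) * L2 ^+ b.
  ring.
have -> : L1 * L2 * (L1 ^+ a * (L2 ^+ b)^`()) = L1 * L1 ^+ a * (L2 * (L2 ^+ b)^`()).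
  ring.
rewrite !step -/L1 -/L2 -!mul_polyC !polyCM !rmorph_nat; ring.
Qed.

Definition rr_mean d a b : R := a%:R * d + b%:R * (1 - d).

Lemma coef_rr_gf_rec0 d a b : d * (1 - d) * (rr_gf d a b)`_1 =
  (rr_mean d a b - (a + b)%:R * (d * (1 - d))) * (rr_gf d a b)`_0.
Proof.
have H := congr1 (fun p : {poly R} => p`_0) (rr_gf_ode d a b).
rewrite -mulrA [(_ + _) * rr_gf _ _ _]mulrDl -!scalerAl coefD !coefZ in H.
rewrite !coef_affine_mul !addr0 !coef_deriv /= mulr1n in H.
rewrite /rr_mean natrD.
have -> : d * (1 - d) * (rr_gf d a b)`_1 = (1 - d) * (d * (rr_gf d a b)`_1) by ring.
rewrite H; ring.
Qed.

(** The product of the two affine factors has coefficients [s], [1 - 2 * s], [s], the middle one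
    being [d ^+ 2 + (1 - d) ^+ 2]. *)
Lemma coef_rr_gf_rec d a b j : let w i := (rr_gf d a b)`_i in
  let s := d * (1 - d) in
  s * j.+2%:R * w j.+2 - s * ((a + b)%:R - j%:R) * w j =
  (rr_mean d a b - (a + b)%:R * s - (1 - 2 * s) * j.+1%:R) * w j.+1.
Proof.
move=> w s; have H := congr1 (fun p : {poly R} => p`_j.+1) (rr_gf_ode d a b).
rewrite -mulrA [(_ + _) * rr_gf _ _ _]mulrDl -!scalerAl coefD !coefZ in H.
move: H; rewrite !coef_affine_mul !coef_deriv -/(w _) -/(w _) -/(w _).
rewrite -[w j.+2 *+ _]mulr_natr -[w j.+1 *+ _]mulr_natr.
case: j => [|j].
  rewrite /rr_mean /s natrD => H; lra.
rewrite !coef_deriv -/(w _).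
rewrite -[w j.+1 *+ _]mulr_natr.
rewrite -(natr1 j.+2) -(natr1 j.+1) /rr_mean /s natrD => H; lra.
Qed.

(* The recurrence at [i.+1] times [w i], with [w i * w i.+2 <= w i.+1 ^+ 2], is a
   quadratic inequality in [w i - w i.+1] whose quadratic term has a sign. *)
Lemma rr_gf_ratio_le d a b i : 0 < d < 1 -> (i < a + b)%N ->
  let w j := (rr_gf d a b)`_j in let s := d * (1 - d) in
  (s * (a + b).+2%:R - (i.+1%:R - rr_mean d a b)) * w i <=
    s * (a + b).+2%:R * w i.+1.
Proof.
move=> /= d01 iab; set w := fun j => (rr_gf d a b)`_j; set s := d * (1 - d).
rewrite -?/(w _); have /andP[d0 d1] := d01.
have s0 : 0 < s by rewrite mulr_gt0// subr_gt0.
have w0 : 0 < w i by apply: coef_rr_gf_gt0 => //; exact: ltnW.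
have w1 : 0 < w i.+1 by apply: coef_rr_gf_gt0.
have rec := coef_rr_gf_rec d a b i; rewrite /= -/(w _) -/(w _) -/(w _) -/s in rec.
have lc : w i * w i.+2 <= w i.+1 * w i.+1 by exact: log_concave_rr_gf.
have Ni : (i%:R : R) <= (a + b)%:R by rewrite ler_nat ltnW.
set N : R := (a + b)%:R in Ni rec *.
rewrite -(natr1 (a + b).+1) -(natr1 (a + b)) -/N.
rewrite -(natr1 i.+1) -(natr1 i) in rec *.
set x : R := i%:R in Ni rec *; set m := rr_mean d a b in rec *.
have x0 : 0 <= x by exact: ler0n.
have H1 : s * (x + 1 + 1) * (w i * w i.+2) <= s * (x + 1 + 1) * (w i.+1 * w i.+1).
  by rewrite ler_wpM2l// mulr_ge0 ?(ltW s0)// !addr_ge0.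
have H2 : 0 <= s * (N - x) * (w i - w i.+1) ^+ 2.
  by rewrite mulr_ge0 ?sqr_ge0// mulr_ge0 ?subr_ge0 ?(ltW s0).
have H3 := congr1 ( *%R (w i)) rec.
rewrite -subr_ge0 -(pmulr_rge0 _ w1).
nra.
Qed.

(** The mirror argument: the recurrence centred at [i], times [w i.+1], with the left neighbour
    eliminated. The two outer coefficients of the recurrence add up to [s * (a + b).+2%:R] whatever
    the index, so both ratio bounds have the same denominator. *)
Lemma rr_gf_ratio_ge d a b i : 0 < d < 1 -> (i < a + b)%N ->
  let w j := (rr_gf d a b)`_j in let s := d * (1 - d) in
  (s * (a + b).+2%:R + (i%:R - rr_mean d a b)) * w i.+1 <=
    s * (a + b).+2%:R * w i.
Proof.
move=> /= d01 iab; set w := fun j => (rr_gf d a b)`_j; set s := d * (1 - d).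
rewrite -?/(w _); have /andP[d0 d1] := d01.
have s0 : 0 < s by rewrite mulr_gt0// subr_gt0.
have w0 : 0 < w i by apply: coef_rr_gf_gt0 => //; exact: ltnW.
have w1 : 0 < w i.+1 by apply: coef_rr_gf_gt0.
rewrite -(natr1 (a + b).+1) -(natr1 (a + b)).
rewrite -subr_ge0 -(pmulr_rge0 _ w0).
(* At index 0 there is no left neighbour to eliminate; the constant coefficient of the differential
   equation already relates the two coefficients. *)
case: i iab w0 w1 => [|i] iab w0 w1.
  have rec := coef_rr_gf_rec0 d a b; rewrite -/(w _) -/(w _) -/s in rec.
  set N : R := (a + b)%:R in rec *; set m := rr_mean d a b in rec *.
  have N0 : 0 <= N by exact: ler0n.
  have H1 : 0 <= s * (w 1%N - w 0%N) ^+ 2 by rewrite mulr_ge0 ?sqr_ge0// (ltW s0).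
  have H2 : 0 <= s * (N + 1) * w 0%N ^+ 2.
    by rewrite mulr_ge0 ?sqr_ge0// mulr_ge0 ?(ltW s0)// addr_ge0.
  have H3 := congr1 ( *%R (w 1%N)) rec.
  nra.
have rec := coef_rr_gf_rec d a b i; rewrite /= -/(w _) -/(w _) -/(w _) -/s in rec.
have lc : w i * w i.+2 <= w i.+1 * w i.+1 by exact: log_concave_rr_gf.
have Ni : (i%:R : R) <= (a + b)%:R by rewrite ler_nat ltnW// ltnW.
set N : R := (a + b)%:R in Ni rec *.
rewrite -(natr1 i.+1) -(natr1 i) in rec *.
set x : R := i%:R in Ni rec *; set m := rr_mean d a b in rec *.
have x0 : 0 <= x by exact: ler0n.
have H1 : s * (N - x) * (w i * w i.+2) <= s * (N - x) * (w i.+1 * w i.+1).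
  by rewrite ler_wpM2l// mulr_ge0 ?subr_ge0 ?(ltW s0).
have H2 : 0 <= s * (x + 1 + 1) * (w i.+2 - w i.+1) ^+ 2.
  by rewrite mulr_ge0 ?sqr_ge0// mulr_ge0 ?(ltW s0)// !addr_ge0.
have H3 := congr1 ( *%R (w i.+2)) rec.
nra.
Qed.

Lemma horner_rr_gf1 d a b : (rr_gf d a b).[1] = 1.
Proof.
by rewrite /rr_gf hornerM !horner_exp !hornerE/= subrK addrAC subrr add0r !expr1n mulr1.
Qed.

Lemma sum_coef_rr_gf d a b :
  \sum_(j < (a + b).+1) (rr_gf d a b)`_j = 1.
Proof.
rewrite -(horner_rr_gf1 d a b) (horner_coef_wide _ (size_rr_gf d a b)).
by apply: eq_bigr => i _; rewrite expr1n mulr1.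
Qed.

Lemma sum_coef_deriv p n : (size p <= n)%N ->
  \sum_(j < n) j%:R * p`_j = p^`().[1].
Proof.
case: n => [|n] szp.
  by rewrite big_ord0 (size_poly_leq0P _ szp) deriv0 horner0.
rewrite (@horner_coef_wide _ n); last first.
  by apply/leq_sizeP => j nj; rewrite coef_deriv (leq_sizeP _ _ szp) ?mul0rn.
rewrite big_ord_recl/= mul0r add0r; apply: eq_bigr => i _.
by rewrite expr1n mulr1 coef_deriv mulr_natl.
Qed.

(** The differential equation at 1 gives the first derivative of [G] there, and its derivative at 1
    gives the second; these are the first two factorial moments. *)
Lemma rr_gf_variance d a b :
  \sum_(j < (a + b).+1) (j%:R - rr_mean d a b) ^+ 2 * (rr_gf d a b)`_j =
  (a + b)%:R * (d * (1 - d)).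
Proof.
set G := rr_gf d a b; set m := rr_mean d a b.
have szG := size_rr_gf d a b.
have szG' : (size G^`() <= a + b)%N.
  by apply/leq_sizeP => j nj; rewrite coef_deriv (leq_sizeP _ _ szG) ?mul0rn.
have m0 := sum_coef_rr_gf d a b.
have m1 := sum_coef_deriv szG.
have m2 : \sum_(j < (a + b).+1) (j%:R * (j%:R - 1)) * G`_j = G^`()^`().[1].
  rewrite -(sum_coef_deriv szG') big_ord_recl/= !mul0r add0r.
  by apply: eq_bigr => i _; rewrite coef_deriv -mulr_natr -natr1; ring.
transitivity (G^`()^`().[1] + (1 - 2 * m) * G^`().[1] + m ^+ 2).
  have -> : m ^+ 2 = \sum_(j < (a + b).+1) m ^+ 2 * G`_j.
    by rewrite -big_distrr/= m0 mulr1.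
  rewrite -m2 -m1 !big_distrr/= -!big_split/=.
  by apply: eq_bigr => i _; rewrite -/G; ring.
have g1 : G.[1] = 1 by exact: horner_rr_gf1.
have ode := rr_gf_ode d a b; rewrite -/G in ode.
rewrite /m /rr_mean natrD; clearbody G; move: ode g1; clear.
move=> /[dup] /(congr1 (horner^~ 1)) /= ode1 /(congr1 (fun p => p^`().[1])) /=.
rewrite !derivM !derivD !derivZ !derivD !derivZ !derivC !derivX.
move: ode1; rewrite !hornerE/= => d1 d2 g1.
rewrite g1 in d1 d2.
have {}d1 : G^`().[1] = a%:R * d + b%:R * (1 - d) by move: d1; nra.
rewrite d1 in d2 *; move: d2; nra.
Qed.
End generating_function.

(** * The standard normal distribution function *)

Section standard_normal_cdf.
Context {R : realType}.
Implicit Types (a b u l c : R).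

Definition Phi (r : R) : R := fine (normal_prob 0 1 `]-oo, r]).

Lemma PhiE r : normal_prob 0 1 `]-oo, r] = (Phi r)%:E.
Proof. by rewrite fineK// fin_num_measure. Qed.

Lemma Phi_ge0 r : 0 <= Phi r.
Proof. by rewrite fine_ge0// measure_ge0. Qed.

Lemma Phi_le1 r : Phi r <= 1.
Proof. by rewrite -lee_fin -PhiE probability_le1. Qed.

Lemma Phi_increment a b : a <= b ->
  (Phi b - Phi a)%:E = normal_prob 0 1 `]a, b].
Proof.
move=> ab.
have : normal_prob 0 1 `]-oo, b] = (normal_prob 0 1 `]-oo, a] + normal_prob (0:R) 1 `]a, b])%E.
  rewrite -measureU//.
    by congr (normal_prob _ _ _); rewrite -itv_bndbnd_setU.
  apply/seteqP; split=> x //=; rewrite !in_itv/= => -[xa /andP[ax _]].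
  by move: (lt_le_trans ax xa); rewrite ltxx.
rewrite !PhiE EFinB => ->; rewrite addeAC subee ?add0e//.
Qed.

Lemma Phi_nondecreasing : {homo Phi : a b / a <= b}.
Proof.
by move=> a b ab; rewrite -subr_ge0 -lee_fin Phi_increment// measure_ge0.
Qed.

Lemma normal_prob_bounds l c A : measurable A -> 0 <= l ->
  (forall x, A x -> l <= normal_pdf 0 1 x <= c) ->
  (l%:E * lebesgue_measure A <= normal_prob (0 : R) 1 A <= c%:E * lebesgue_measure A)%E.
Proof.
move=> mA l0 H.
rewrite -!integral_cst// /normal_prob; apply/andP; split.
- apply: ge0_le_integral => //=.
  + by apply/measurable_funTS/measurable_EFinP; exact: measurable_normal_pdf.
  + by move=> x /H/andP[]; rewrite lee_fin.
- apply: ge0_le_integral => //=.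
  + by move=> x _; rewrite lee_fin normal_pdf_ge0.
  + by apply/measurable_funTS/measurable_EFinP; exact: measurable_normal_pdf.
  + by move=> x /H/andP[]; rewrite lee_fin.
Qed.

Lemma Phi_increment_bounds a u l c : 0 <= u -> 0 <= l ->
  (forall x, a <= x <= a + u -> l <= normal_pdf 0 1 x <= c) ->
  l * u <= Phi (a + u) - Phi a <= c * u.
Proof.
move=> u0 l0 H; have ab : a <= a + u by rewrite lerDl.
have := @normal_prob_bounds l c `]a, (a + u)] _ l0 _.
rewrite -Phi_increment// lebesgue_measure_itv/= lte_fin.
have -> : (if a < a + u then ((a + u)%:E - a%:E)%E else 0%E) = u%:E.
  case: ltP => h; first by rewrite -EFinB addrAC subrr add0r.
  by congr (_%:E); apply/eqP; rewrite eq_le u0 /= -(lerD2l a) addr0.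
rewrite -!EFinM !lee_fin; apply => // x; rewrite in_itv/= => /andP[ax xb].
by apply: H; rewrite (ltW ax).
Qed.

(** [Phi] is the distribution function of the identity under the normal law, so it inherits the
    limits of [cdf] at both infinities. *)
Let id_rv : measurableTypeR R -> R := idfun.

#[local] HB.instance Definition _ :=
  @isMeasurableFun.Build _ _ _ _ id_rv (@measurable_id _ _ setT).

Let Phi_cdf : Phi = fine \o cdf (id_rv : {RV (normal_prob (0 : R) 1) >-> R}).
Proof. by []. Qed.

Lemma cvg_Phi_ninfty : Phi r @[r --> -oo] --> (0 : R).
Proof. by rewrite Phi_cdf; apply: fine_cvg; exact: cvg_cdfNy0. Qed.

Lemma cvg_Phi_pinfty : Phi r @[r --> +oo] --> (1 : R).
Proof. by rewrite Phi_cdf; apply: fine_cvg; exact: cvg_cdfy1. Qed.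

(** A converse to [1 + u <= expR u], with quadratic loss. Inverting [expR_ge1Dx] at the opposite
    exponent, it amounts to [(1 + u) * (1 - u + 2 * u ^+ 2) = 1 + u ^+ 2 * (1 + 2 * u) >= 1], which
    is where [- 2^-1 <= u] enters. *)
Lemma expR_sub_sqr u : - 2^-1 <= u -> expR (u - 2 * u ^+ 2) <= 1 + u.
Proof.
move=> hu.
have h1 : 0 < 1 - (u - 2 * u ^+ 2) by nra.
have h2 := expR_ge1Dx (- (u - 2 * u ^+ 2)).
rewrite -[leLHS]invrK -expRN invf_ple ?posrE ?expR_gt0//; last by nra.
apply: le_trans h2; rewrite -[leLHS]mulr1 ler_pdivrMl ?posrE; last by nra.
nra.
Qed.

End standard_normal_cdf.

(** * From ratio bounds to the central limit theorem *)

Section local_limit.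
Context {R : realType}.
Implicit Types (mu tau K d : R) (p : nat -> R).

Definition standardize mu tau (j : nat) : R := (j%:R - mu) * tau.

Lemma standardizeS mu tau j :
  standardize mu tau j.+1 = standardize mu tau j + tau.
Proof. by rewrite /standardize -natr1; ring. Qed.

Lemma standardize_nondecreasing mu tau : 0 <= tau ->
  {homo standardize mu tau : i j / (i <= j)%N >-> i <= j}.
Proof.
move=> t0 i j ij; rewrite /standardize ler_wpM2r// lerD2r.
by rewrite ler_nat.
Qed.

(* Up to a constant factor, the ratio of the pmf to the normal density. *)
Definition tilt mu tau p j : R := p j * expR (standardize mu tau j ^+ 2 / 2).

(** [x * tau + tau ^+ 2 / 2] is the increment of [x ^+ 2 / 2] over one step, and [1 + x * tau * nu]
    the form that the ratio bounds take. With [k = K * tau], the exponents lose [2 * k ^+ 2] from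
    [expR_sub_sqr], [tau ^+ 2 / 4] from [nu] and [tau ^+ 2 / 2] from the step, in all at most
    [3 * k ^+ 2]. *)
Lemma expR_step_le (x tau K nu : R) : `|x| <= K -> 1 <= K -> 0 < tau ->
  K * tau <= 2^-1 -> 0 <= nu <= 1 -> 1 - nu <= tau ^+ 2 / 2 ->
  expR (x * tau + tau ^+ 2 / 2) <= expR (3 * K ^+ 2 * tau ^+ 2) * (1 + x * tau * nu).
Proof.
rewrite ler_norml => /andP[xl xu] K1 t0 Kt /andP[nu0 nu1] hnu.
have xt1 : x * tau <= K * tau by rewrite ler_wpM2r// ltW.
have xt2 : - (K * tau) <= x * tau by rewrite -mulNr ler_wpM2r// ltW.
set y := x * tau in xt1 xt2 *; set k := K * tau in xt1 xt2 Kt.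
have k0 : 0 <= k by rewrite mulr_ge0 ?(ltW t0)//; lra.
have tk : tau ^+ 2 <= k ^+ 2 by rewrite ler_pXn2r ?nnegrE ?(ltW t0)// ler_peMl ?(ltW t0).
have y2 : y ^+ 2 <= k ^+ 2 by nra.
have u2 : (y * nu) ^+ 2 <= k ^+ 2.
  rewrite exprMn (le_trans _ y2)// ler_piMr ?sqr_ge0//; nra.
have yn : y * (1 - nu) <= 2^-1 * (tau ^+ 2 / 2).
  apply: (@le_trans _ _ (2^-1 * (1 - nu))); last by rewrite ler_wpM2l.
  by rewrite ler_wpM2r ?subr_ge0// (le_trans xt1).
have u0 : - 2^-1 <= y * nu by nra.
apply: le_trans (ler_wpM2l (expR_ge0 _) (expR_sub_sqr u0)).
rewrite -expRD ler_expR.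
have -> : 3 * K ^+ 2 * tau ^+ 2 = 3 * k ^+ 2 by rewrite /k; ring.
nra.
Qed.

(** Two points of the window are at most [2 * K / tau] steps apart, and each step costs
    [C * tau ^+ 2] in the exponent. *)
Lemma tilt_chain mu tau K C (N : nat) p : (forall j, 0 <= p j) ->
  0 < tau -> 0 <= K -> 0 <= C ->
  (forall i, (i < N)%N -> `|standardize mu tau i| <= K ->
    `|standardize mu tau i.+1| <= K ->
    tilt mu tau p i.+1 <= expR (C * tau ^+ 2) * tilt mu tau p i /\
    tilt mu tau p i <= expR (C * tau ^+ 2) * tilt mu tau p i.+1) ->
  forall i j, (i <= N)%N -> (j <= N)%N -> `|standardize mu tau i| <= K ->
    `|standardize mu tau j| <= K ->
    tilt mu tau p i <= expR (2 * K * C * tau) * tilt mu tau p j.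
Proof.
move=> p0 t0 K0 C0 H.
have main i m : (i + m <= N)%N -> `|standardize mu tau i| <= K ->
    `|standardize mu tau (i + m)| <= K ->
    tilt mu tau p (i + m) <= expR (m%:R * (C * tau ^+ 2)) * tilt mu tau p i /\
    tilt mu tau p i <= expR (m%:R * (C * tau ^+ 2)) * tilt mu tau p (i + m).
  elim: m => [|m IH]; first by rewrite addn0 mul0r expR0 mul1r.
  rewrite addnS => imN xi xm.
  have xim : `|standardize mu tau (i + m)| <= K.
    move: xi xm; rewrite !ler_norml => /andP[xi _] /andP[_ xm].
    rewrite (le_trans xi) ?(le_trans _ xm)//.
    - by rewrite standardizeS lerDl ltW.
    - by apply: standardize_nondecreasing; rewrite ?(ltW t0)// leq_addr.
  have [IH1 IH2] := IH (ltnW imN) xi xim.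
  have [H1 H2] := H _ imN xim xm.
  rewrite -natr1 mulrDl mul1r expRD; split.
  - apply: (le_trans H1); rewrite [expR _ * expR _]mulrC -mulrA ler_wpM2l ?expR_ge0//.
  - apply: (le_trans IH2); rewrite -mulrA ler_wpM2l ?expR_ge0//.
have q0 j : 0 <= tilt mu tau p j by rewrite mulr_ge0 ?expR_ge0.
have mle i m : `|standardize mu tau i| <= K -> `|standardize mu tau (i + m)| <= K ->
    expR (m%:R * (C * tau ^+ 2)) <= expR (2 * K * C * tau).
  rewrite !ler_norml => /andP[xi _] /andP[_ xm]; rewrite ler_expR.
  have mt : m%:R * tau <= 2 * K.
    by move: xi xm; rewrite /standardize natrD !mulrDl; lra.
  have -> : m%:R * (C * tau ^+ 2) = m%:R * tau * (C * tau) by ring.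
  by rewrite -(mulrA (2 * K)) ler_wpM2r// mulr_ge0// ltW.
move=> i j iN jN xi xj.
have [ij|/ltnW ij] := leqP i j.
- have [] := main i (j - i)%N; rewrite ?subnKC// => _ H2.
  apply: le_trans H2 _; rewrite ler_wpM2r//.
  by apply: (mle i); rewrite ?subnKC.
- have [] := main j (i - j)%N; rewrite ?subnKC// => H1 _.
  apply: le_trans H1 _; rewrite ler_wpM2r//.
  by apply: (mle j); rewrite ?subnKC.
Qed.

(** The mass of a cell, rather than the density at a point, makes sums over consecutive [j]
    telescope to increments of [Phi]. *)
Definition normal_cell mu tau j : R :=
  Phi (standardize mu tau j.+1) - Phi (standardize mu tau j).

Lemma normal_cell_ge0 mu tau j : 0 <= tau -> 0 <= normal_cell mu tau j.
Proof.
by move=> t0; rewrite subr_ge0 Phi_nondecreasing// standardize_nondecreasing.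
Qed.

Lemma normal_cell_bounds mu tau K j : 0 <= tau -> tau <= 1 -> 1 <= K ->
  `|standardize mu tau j| <= K ->
  let c := normal_peak 1 * expR (- (standardize mu tau j ^+ 2 / 2)) * tau in
  expR (- (2 * K * tau)) * c <= normal_cell mu tau j <= expR (2 * K * tau) * c.
Proof.
move=> t0 t1 K1; rewrite ler_norml => /andP[xl xu] /=.
rewrite /normal_cell standardizeS; move: (standardize _ _ _) xl xu => x xl xu.
rewrite !mulrA; apply: Phi_increment_bounds => //.
  by rewrite !mulr_ge0 ?expR_ge0 ?normal_peak_ge0.
move=> y /andP[xy yx].
rewrite normal_pdfE ?oner_neq0// /normal_fun subr0 expr1n.
rewrite -!mulrA !(mulrCA _ (normal_peak 1)) -!expRD.
(* Within a cell [y ^+ 2 / 2] moves by at most [3 / 2 * K * tau], which the exponent [2 * K * tau]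
   covers. *)
have h : (y - x) * `|y + x| <= tau * (3 * K).
  rewrite ler_pM ?normr_ge0 ?subr_ge0//; first by rewrite lerBlDl.
  by rewrite ler_norml; apply/andP; split; lra.
have h1 : `|(y - x) * (y + x)| <= tau * (3 * K).
  by rewrite normrM (ger0_norm (_ : 0 <= y - x)) ?subr_ge0.
have Kt : 0 <= K * tau by rewrite mulr_ge0//; lra.
move: h1; rewrite ler_norml => /andP[h1 h2].
by rewrite !ler_wpM2l ?normal_peak_ge0// ler_expR; nra.
Qed.

(** The cross-multiplied form cancels both [normal_peak] and the normalization of [p]. Replacing the
    density by a cell costs [2 * K * tau] at each of the two points. *)
Lemma tilt_cell mu tau K C (N : nat) p : (forall j, 0 <= p j) ->
  0 < tau -> tau <= 1 -> 1 <= K ->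
  (forall i j, (i <= N)%N -> (j <= N)%N -> `|standardize mu tau i| <= K ->
    `|standardize mu tau j| <= K ->
    tilt mu tau p i <= expR C * tilt mu tau p j) ->
  forall i j, (i <= N)%N -> (j <= N)%N -> `|standardize mu tau i| <= K ->
    `|standardize mu tau j| <= K ->
  p i * normal_cell mu tau j <= expR (C + 4 * K * tau) * (p j * normal_cell mu tau i).
Proof.
move=> p0 t0 t1 K1 H i j iN jN xi xj.
have /= /andP[_ gj] := normal_cell_bounds (ltW t0) t1 K1 xj.
have /= /andP[gi _] := normal_cell_bounds (ltW t0) t1 K1 xi.
have Hij := H i j iN jN xi xj.
move: Hij gi gj; rewrite /tilt.
set xi2 := standardize mu tau i ^+ 2 / 2; set xj2 := standardize mu tau j ^+ 2 / 2.
set c := normal_peak 1 => Hij gi gj.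
have c0 : 0 <= c by rewrite normal_peak_ge0.
apply: le_trans (ler_wpM2l (p0 i) gj) _.
have -> : expR (C + 4 * K * tau) = expR C * expR (2 * K * tau) * expR (2 * K * tau).
  by rewrite -!expRD; congr expR; ring.
have {gi} : expR (2 * K * tau) * (expR (- (2 * K * tau)) * (c * expR (- xi2) * tau)) <=
    expR (2 * K * tau) * normal_cell mu tau i by rewrite ler_wpM2l ?expR_ge0.
rewrite mulrA -expRD subrr expR0 mul1r => gi.
have : expR C * expR (2 * K * tau) * p j * (c * expR (- xi2) * tau) <=
  expR C * expR (2 * K * tau) * p j * (expR (2 * K * tau) * normal_cell mu tau i).
  by rewrite ler_wpM2l// !mulr_ge0 ?expR_ge0.
have {Hij} : expR (- xi2) * expR (- xj2) * (p i * expR xi2) <=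
    expR (- xi2) * expR (- xj2) * (expR C * (p j * expR xj2)).
  by rewrite ler_wpM2l// mulr_ge0 ?expR_ge0.
have ei : expR (- xi2) * expR xi2 = 1 by rewrite -expRD addrC subrr expR0.
have ej : expR (- xj2) * expR xj2 = 1 by rewrite -expRD addrC subrr expR0.
have -> : expR (- xi2) * expR (- xj2) * (p i * expR xi2) =
  (expR (- xi2) * expR xi2) * (p i * expR (- xj2)) by ring.
have -> : expR (- xi2) * expR (- xj2) * (expR C * (p j * expR xj2)) =
  (expR (- xj2) * expR xj2) * (expR C * p j * expR (- xi2)) by ring.
rewrite ei ej !mul1r => Hij H2.
have : expR (2 * K * tau) * c * tau * (p i * expR (- xj2)) <=
   expR (2 * K * tau) * c * tau * (expR C * p j * expR (- xi2)).
  by rewrite ler_wpM2l// !mulr_ge0 ?expR_ge0 ?(ltW t0).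
move=> H3; apply: le_trans (le_trans _ (le_trans H3 _)) (le_trans H2 _).
- lra.
- lra.
- lra.
Qed.

(** Clipping the endpoints at [s + tau] leaves the cells of [A] intact and keeps all increments
    nonnegative, so the full sum telescopes even when [A] is not an interval. *)
Lemma sum_cell_le mu tau (N : nat) (A : pred nat) s : 0 <= tau ->
  (forall j, A j -> standardize mu tau j <= s) ->
  \sum_(j < N.+1 | A j) normal_cell mu tau j <= Phi (s + tau).
Proof.
move=> t0 As; pose f j := Phi (Num.min (standardize mu tau j) (s + tau)).
have fS j : f j <= f j.+1.
  apply: Phi_nondecreasing; rewrite le_min !ge_min lexx orbT andbT.
  by rewrite standardize_nondecreasing.
apply: (@le_trans _ _ (\sum_(j < N.+1) (f j.+1 - f j))).
  rewrite big_mkcond; apply: ler_sum => j _; case: ifPn => Aj; last by rewrite subr_ge0.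
  have xs := As _ Aj; rewrite /f /normal_cell !min_l//.
  - by rewrite (le_trans xs)// lerDl.
  - by rewrite standardizeS lerD2r.
rewrite -(big_mkord predT (fun j => f j.+1 - f j)) telescope_sumr//.
rewrite lerBlDr (@le_trans _ _ (Phi (s + tau)))//; last by rewrite lerDl Phi_ge0.
by apply: Phi_nondecreasing; rewrite ge_min lexx orbT.
Qed.

(** Clamping the endpoints to the interval from [a] to [b] kills every cell that misses it; the
    remaining ones belong to [A]. *)
Lemma sum_cell_ge mu tau (N : nat) (A : pred nat) a b : 0 <= tau -> a <= b ->
  standardize mu tau 0 <= a -> b <= standardize mu tau N.+1 ->
  (forall j, (j <= N)%N -> a < standardize mu tau j.+1 -> standardize mu tau j < b ->
    A j) ->
  Phi b - Phi a <= \sum_(j < N.+1 | A j) normal_cell mu tau j.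
Proof.
move=> t0 ab xa bx HA.
pose f j := Phi (Num.max a (Num.min (standardize mu tau j) b)).
have -> : Phi b - Phi a = f N.+1 - f 0%N.
  congr (Phi _ - Phi _); first by rewrite min_r// max_r.
  by rewrite min_l ?max_l// (le_trans xa).
rewrite -(telescope_sumr f)// big_mkord [leRHS]big_mkcond; apply: ler_sum => j _.
have xS : standardize mu tau j <= standardize mu tau j.+1.
  exact: standardize_nondecreasing.
have [xja|axj] := leP (standardize mu tau j.+1) a.
  rewrite /f (min_l (le_trans xja ab)) (max_l xja).
  rewrite (min_l (le_trans xS (le_trans xja ab))) (max_l (le_trans xS xja)) subrr.
  by case: ifP => // _; exact: normal_cell_ge0.
have [bxj|xjb] := leP b (standardize mu tau j).
  rewrite /f (min_r bxj) (min_r (le_trans bxj xS)) subrr.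
  by case: ifP => // _; exact: normal_cell_ge0.
have jN : (j <= N)%N by rewrite -ltnS.
rewrite HA// /f /normal_cell lerB// Phi_nondecreasing//.
  by rewrite ge_max (ltW axj) ge_min lexx.
by rewrite (min_l (ltW xjb)) le_max lexx orbT.
Qed.

Lemma window_compare mu tau K lam (N : nat) p (A B : pred nat) :
  (forall j, A j -> `|standardize mu tau j| <= K) ->
  (forall j, B j -> `|standardize mu tau j| <= K) ->
  (forall i j, (i <= N)%N -> (j <= N)%N -> `|standardize mu tau i| <= K ->
    `|standardize mu tau j| <= K ->
    p i * normal_cell mu tau j <= lam * (p j * normal_cell mu tau i)) ->
  (\sum_(i < N.+1 | A i) p i) * (\sum_(j < N.+1 | B j) normal_cell mu tau j) <=
  lam * ((\sum_(j < N.+1 | B j) p j) * (\sum_(i < N.+1 | A i) normal_cell mu tau i)).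
Proof.
move=> AK BK H; rewrite !big_distrlr/= [X in lam * X]exchange_big/= big_distrr/=.
apply: ler_sum => i Ai; rewrite big_distrr/=; apply: ler_sum => j Bj.
by apply: H; [rewrite -ltnS|rewrite -ltnS|exact: AK|exact: BK].
Qed.

Lemma chebyshev_window mu tau K (N : nat) p : 0 < K -> (forall j, 0 <= p j) ->
  \sum_(j < N.+1) standardize mu tau j ^+ 2 * p j <= 1 ->
  \sum_(j < N.+1 | ~~ (`|standardize mu tau j| <= K)) p j <= K ^- 2.
Proof.
move=> K0 p0 H; have K2 : 0 < K ^+ 2 by rewrite exprn_gt0.
rewrite -[leRHS]mul1r ler_pdivlMr// (le_trans _ H)// big_distrl/= big_mkcond.
apply: ler_sum => j _; case: ifPn; last by rewrite mulr_ge0 ?sqr_ge0.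
rewrite -ltNge => Kx; rewrite mulrC ler_wpM2r//.
rewrite -(real_normK (num_real (standardize mu tau j))).
by rewrite ler_pXn2r ?nnegrE ?(ltW K0)// ltW.
Qed.

(** The part of the event [X j <= t] inside the window is compared with the whole window [W], in
    both directions. [W] has [p]-mass at least [1 - K ^- 2] by Chebyshev, and its cells have total
    mass at least [Phi K - Phi (1 - K)]. *)
Lemma cdf_window mu tau K lam eps t (N : nat) p (X : nat -> R) :
  (forall j, 0 <= p j) -> \sum_(j < N.+1) p j = 1 ->
  \sum_(j < N.+1) standardize mu tau j ^+ 2 * p j <= 1 ->
  0 < tau -> tau <= 1 -> 1 <= K -> 0 <= lam ->
  standardize mu tau 0 <= - K -> K <= standardize mu tau N ->
  (forall i j, (i <= N)%N -> (j <= N)%N -> `|standardize mu tau i| <= K ->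
    `|standardize mu tau j| <= K ->
    p i * normal_cell mu tau j <= lam * (p j * normal_cell mu tau i)) ->
  (forall j, (j <= N)%N -> `|standardize mu tau j| <= K ->
    `|X j - standardize mu tau j| <= eps) ->
  let F := \sum_(j < N.+1 | X j <= t) p j in
  (F - K ^- 2) * (Phi K - Phi (1 - K)) <= lam * Phi (t + eps + tau) /\
  (t - eps <= K -> (1 - K ^- 2) * (Phi (t - eps) - Phi (1 - K)) <= lam * F).
Proof.
move=> p0 p1 var t0 t1 K1 lam0 x0 xN cmp HX F.
have K0 : 0 < K by lra.
pose W j := (j <= N)%N && (`|standardize mu tau j| <= K).
pose A j := W j && (X j <= t).
have AW j : A j -> W j by case/andP.
have WK j : W j -> `|standardize mu tau j| <= K by case/andP.
have AK j : A j -> `|standardize mu tau j| <= K by move=> /AW/WK.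
have xN1 : K <= standardize mu tau N.+1.
  by rewrite (le_trans xN)// standardize_nondecreasing// ltW.
have tail := chebyshev_window K0 p0 var.
have PW1 : 1 - K ^- 2 <= \sum_(j < N.+1 | W j) p j.
  rewrite lerBlDr -p1 (bigID (fun j : 'I_N.+1 => W j))/= lerD2l.
  apply: le_trans tail; rewrite le_eqVlt; apply/orP; left; apply/eqP.
  by apply: eq_bigl => j; rewrite /W -ltnS ltn_ord.
have PWle : \sum_(j < N.+1 | W j) p j <= 1.
  by rewrite -p1 [leRHS](bigID (fun j : 'I_N.+1 => W j))/= lerDl sumr_ge0.
have FA : F - K ^- 2 <= \sum_(j < N.+1 | A j) p j.
  rewrite lerBlDr /F (bigID (fun j : 'I_N.+1 => W j))/=; apply: lerD.
    by rewrite le_eqVlt; apply/orP; left; apply/eqP/eq_bigl => j; rewrite /A andbC.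
  apply: le_trans tail; rewrite [leLHS]big_mkcond [leRHS]big_mkcond/=.
  apply: ler_sum => j _; rewrite /W -ltnS ltn_ord/=.
  by case: ifPn => [/andP[_ ->]//|_]; case: ifP.
have AF : \sum_(j < N.+1 | A j) p j <= F.
  rewrite /F [leLHS]big_mkcond [leRHS]big_mkcond/=.
  apply: ler_sum => j _; rewrite /A; case: (X j <= t); rewrite ?andbF//.
  by case: ifP.
have GA0 : 0 <= \sum_(j < N.+1 | A j) normal_cell mu tau j.
  by apply: sumr_ge0 => j _; rewrite normal_cell_ge0// ltW.
have PA0 : 0 <= \sum_(j < N.+1 | A j) p j by exact: sumr_ge0.
have PW0 : 0 <= \sum_(j < N.+1 | W j) p j by exact: sumr_ge0.
have GW0 : 0 <= \sum_(j < N.+1 | W j) normal_cell mu tau j.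
  by apply: sumr_ge0 => j _; rewrite normal_cell_ge0// ltW.
have GWle : \sum_(j < N.+1 | W j) normal_cell mu tau j <= 1.
  apply: le_trans (Phi_le1 (K + tau)); apply: sum_cell_le; first exact: ltW.
  by move=> j /WK; rewrite ler_norml => /andP[].
(* A cell is indexed by its left endpoint. If it reaches beyond [1 - K] it starts above [- K], as
   [tau <= 1]; hence [1 - K] instead of [- K]. *)
have inW b j : b <= K -> (j <= N)%N -> 1 - K < standardize mu tau j.+1 ->
    standardize mu tau j < b -> W j.
  move=> bK jN; rewrite standardizeS => h1 h2; rewrite /W jN ler_norml/=.
  by apply/andP; split; lra.
have cAW := window_compare AK WK cmp; have cWA := window_compare WK AK cmp.
split.
- have GWge : Phi K - Phi (1 - K) <= \sum_(j < N.+1 | W j) normal_cell mu tau j.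
    apply: sum_cell_ge; rewrite ?(ltW t0)//; [lra|lra|].
    by move=> j; exact: inW.
  have PKK : 0 <= Phi K - Phi (1 - K) by rewrite subr_ge0 Phi_nondecreasing//; lra.
  have GAle : \sum_(j < N.+1 | A j) normal_cell mu tau j <= Phi (t + eps + tau).
    apply: sum_cell_le; first exact: ltW.
    move=> j /andP[/andP[jN xK] Xt]; have := HX j jN xK.
    by rewrite ler_norml => /andP[h1 h2]; lra.
  apply: le_trans (ler_wpM2r PKK FA) _; apply: le_trans (ler_wpM2l PA0 GWge) _.
  apply: le_trans cAW _; rewrite ler_wpM2l// -[leRHS]mul1r ler_pM//; exact: sumr_ge0.
- move=> tK; have [tl|tg] := leP (1 - K) (t - eps); last first.
    apply: (@le_trans _ _ 0); last by rewrite mulr_ge0// sumr_ge0.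
    apply: mulr_ge0_le0; last by rewrite subr_le0 Phi_nondecreasing// ltW.
    by rewrite subr_ge0 invf_le1 ?exprn_gt0// exprn_ege1.
  have GAge : Phi (t - eps) - Phi (1 - K) <= \sum_(j < N.+1 | A j) normal_cell mu tau j.
    apply: sum_cell_ge; rewrite ?(ltW t0)//; [lra|lra|].
    move=> j jN h1 h2; have Wj := inW _ _ tK jN h1 h2; rewrite /A Wj/=.
    have := HX j jN (WK _ Wj); rewrite ler_norml => /andP[h3 h4]; lra.
  have D0 : 0 <= Phi (t - eps) - Phi (1 - K) by rewrite subr_ge0 Phi_nondecreasing.
  apply: le_trans (ler_wpM2r D0 PW1) _.
  apply: le_trans (ler_wpM2l PW0 GAge) _.
  apply: le_trans cWA _; rewrite ler_wpM2l// (le_trans _ AF)//.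
  by rewrite ler_piMr.
Qed.
End local_limit.

(** * Central limit theorem for the number of output ones *)

Section rr_limit.
Context {R : realType}.
Implicit Types (d K : R) (a b : nat).

Definition rr_var d a b : R := (a + b)%:R * (d * (1 - d)).

(* The inverse of the standard deviation, not of the variance. *)
Definition rr_prec d a b : R := (Num.sqrt (rr_var d a b))^-1.

Lemma rr_var_le d a b : rr_var d a b <= (a + b)%:R / 4.
Proof.
rewrite /rr_var ler_wpM2l//.
have := sqr_ge0 (d - 2^-1); nra.
Qed.

Lemma rr_prec_gt0 d a b : 0 < rr_var d a b -> 0 < rr_prec d a b.
Proof. by move=> v0; rewrite invr_gt0 sqrtr_gt0. Qed.

Lemma rr_prec_sqr d a b : 0 < rr_var d a b ->
  rr_prec d a b ^+ 2 * rr_var d a b = 1.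
Proof.
by move=> v0; rewrite exprVn sqr_sqrtr ?mulVf ?gt_eqF ?ltW.
Qed.

Lemma rr_var_gt0 d a b : 0 < d < 1 -> (0 < a + b)%N -> 0 < rr_var d a b.
Proof.
by move=> /andP[d0 d1] ab; rewrite mulr_gt0 ?ltr0n// mulr_gt0// subr_gt0.
Qed.

Local Notation x_ d a b := (standardize (rr_mean d a b) (rr_prec d a b)).
Local Notation q_ d a b :=
  (tilt (rr_mean d a b) (rr_prec d a b) (fun j => (rr_gf d a b)`_j)).

Lemma rr_gf_tilt_step d a b K i : 0 < d < 1 -> (i < a + b)%N -> 1 <= K ->
  K * rr_prec d a b <= 2^-1 -> `|x_ d a b i| <= K -> `|x_ d a b i.+1| <= K ->
  q_ d a b i.+1 <= expR (3 * K ^+ 2 * rr_prec d a b ^+ 2) * q_ d a b i /\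
  q_ d a b i <= expR (3 * K ^+ 2 * rr_prec d a b ^+ 2) * q_ d a b i.+1.
Proof.
move=> d01 iab K1 Kt xi xi1; have /andP[d0 d1] := d01.
have v0 : 0 < rr_var d a b by rewrite rr_var_gt0// (leq_trans _ iab).
have t0 := rr_prec_gt0 v0; have tv := rr_prec_sqr v0.
have vle := rr_var_le d a b.
have rl := rr_gf_ratio_le d01 iab; have rg := rr_gf_ratio_ge d01 iab.
rewrite /= -(natr1 (a + b).+1) -(natr1 (a + b)) in rl rg.
have s0 : 0 < d * (1 - d) by rewrite mulr_gt0// subr_gt0.
rewrite /tilt standardizeS; move: xi xi1; rewrite standardizeS.
set x := standardize _ _ i; set tau := rr_prec d a b in Kt t0 tv x *.
have xE : x = (i%:R - rr_mean d a b) * tau by [].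
move: tv vle v0; rewrite /rr_var; set N : R := (a + b)%:R in rl rg *.
set s := d * (1 - d) in rl rg s0 *.
have N0 : 0 < N by rewrite ltr0n (leq_trans _ iab).
move: rl rg; set w0 := _`_i; set w1 := _`_i.+1; rewrite -(natr1 i).
move=> rl rg tv vle v0 xi xi1.
(* The variance is [s * N] while the ratio bounds have [s * (N + 2)], so [tau ^+ 2 * nu] is the
   inverse of the latter. As [s <= 1 / 4], [tau ^+ 2 * N >= 4], which gives
   [1 - nu <= tau ^+ 2 / 2]. *)
pose nu := N / (N + 2).
have N2 : 0 < N + 2 by lra.
have nuE : nu * (N + 2) = N by rewrite /nu divfK// gt_eqF.
have nu01 : 0 <= nu <= 1.
  by rewrite /nu divr_ge0 ?(ltW N0) ?(ltW N2)//= ler_pdivrMr// mul1r; lra.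
have hnu : 1 - nu <= tau ^+ 2 / 2.
  have h : 4 <= tau ^+ 2 * N by have := sqr_ge0 tau; nra.
  rewrite -(ler_pM2r N2) mulrBl nuE mul1r mulrDr; nra.
have w00 : 0 <= w0 by exact: coef_rr_gf_ge0.
have w10 : 0 <= w1 by exact: coef_rr_gf_ge0.
have sN2 : 0 < s * (N + 1 + 1) by rewrite mulr_gt0//; lra.
have uE y : y * tau * tau * nu = y / (s * (N + 1 + 1)).
  have -> : s * (N + 1 + 1) = s * (N + 2) by ring.
  have -> : y * tau * tau * nu = y * (tau ^+ 2 * nu) by ring.
  have sN2' : s * (N + 2) != 0 by rewrite mulf_neq0 ?lt0r_neq0.
  congr (y * _); apply: (mulIf sN2'); rewrite mulVf// -[RHS]tv -[in RHS]nuE; ring.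
have R1 : w1 * (1 + x * tau * nu) <= w0.
  rewrite xE uE -(ler_pM2l sN2); apply: le_trans rg; rewrite le_eqVlt.
  apply/orP; left; apply/eqP; field.
  by apply/andP; split; [rewrite gt_eqF//; lra|exact: lt0r_neq0].
have R2 : w0 * (1 + - (x + tau) * tau * nu) <= w1.
  rewrite -(ler_pM2l sN2); apply: le_trans rl; rewrite le_eqVlt.
  have -> : - (x + tau) * tau * nu = - (i%:R + 1 - rr_mean d a b) / (s * (N + 1 + 1)).
    by rewrite -uE xE; ring.
  apply/orP; left; apply/eqP; field.
  by apply/andP; split; [rewrite gt_eqF//; lra|exact: lt0r_neq0].
split.
- have -> : (x + tau) ^+ 2 / 2 = x ^+ 2 / 2 + (x * tau + tau ^+ 2 / 2) by field.
  rewrite expRD.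
  have := expR_step_le xi K1 t0 Kt nu01 hnu.
  set E := expR (x * tau + _); set F := expR (3 * _ * _) => EF.
  have h1 := ler_wpM2l w10 EF.
  have h2 := ler_wpM2l (expR_ge0 (3 * K ^+ 2 * tau ^+ 2)) R1; rewrite -/F in h2.
  have h3 : w1 * E <= F * w0 by nra.
  have := ler_wpM2r (expR_ge0 (x ^+ 2 / 2)) h3; nra.
(* The backward step is the forward estimate after reflection, with [- (x + tau)] in place of
   [x]. *)
- have -> : x ^+ 2 / 2 = (x + tau) ^+ 2 / 2 + (- (x + tau) * tau + tau ^+ 2 / 2) by field.
  rewrite expRD.
  have xi1' : `|- (x + tau)| <= K by rewrite normrN.
  have := expR_step_le xi1' K1 t0 Kt nu01 hnu.
  set E := expR (- (x + tau) * tau + _); set F := expR (3 * _ * _) => EF.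
  have h1 := ler_wpM2l w00 EF.
  have h2 := ler_wpM2l (expR_ge0 (3 * K ^+ 2 * tau ^+ 2)) R2; rewrite -/F in h2.
  have h3 : w0 * E <= F * w1 by nra.
  have := ler_wpM2r (expR_ge0 ((x + tau) ^+ 2 / 2)) h3; nra.
Qed.

Lemma rr_gf_compare d a b K : 0 < d < 1 -> (0 < a + b)%N -> 1 <= K ->
  K * rr_prec d a b <= 2^-1 ->
  let mu := rr_mean d a b in let tau := rr_prec d a b in
  let p j := (rr_gf d a b)`_j in
  forall i j, (i <= a + b)%N -> (j <= a + b)%N -> `|x_ d a b i| <= K ->
    `|x_ d a b j| <= K ->
  p i * normal_cell mu tau j <=
    expR ((6 * K ^+ 3 + 4 * K) * tau) * (p j * normal_cell mu tau i).
Proof.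
move=> d01 ab K1 Kt mu tau p.
have t0 : 0 < tau by apply: rr_prec_gt0; exact: rr_var_gt0.
have t1 : tau <= 1 by rewrite /tau; nra.
have p0 j : 0 <= p j by exact: coef_rr_gf_ge0.
have -> : (6 * K ^+ 3 + 4 * K) * tau = 2 * K * (3 * K ^+ 2) * tau + 4 * K * tau by ring.
apply: tilt_cell => //; apply: tilt_chain => //.
- lra.
- by rewrite mulr_ge0// sqr_ge0.
- by move=> i iab xi xi1; exact: rr_gf_tilt_step.
Qed.

(** Each output bit has variance at most its mean and at most one minus its mean, so both ends of
    the support lie at least [rr_var * tau = 1 / tau] standard deviations from the mean. *)
Lemma rr_window d a b K : 0 < d < 1 -> (0 < a + b)%N ->
  K * rr_prec d a b <= 2^-1 ->
  x_ d a b 0 <= - K /\ K <= x_ d a b (a + b).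
Proof.
move=> d01 ab; have v0 := rr_var_gt0 d01 ab; have /andP[d0 d1] := d01.
have t0 := rr_prec_gt0 v0; have tv := rr_prec_sqr v0.
rewrite /standardize; set tau := rr_prec d a b in t0 tv * => Kt.
have h1 : rr_var d a b <= rr_mean d a b.
  rewrite /rr_var /rr_mean natrD.
  have := ler0n R a; have := ler0n R b; set A := a%:R; set B := b%:R => B0 A0.
  have : 0 <= A * d * d by rewrite !mulr_ge0// ltW.
  have : 0 <= B * (1 - d) * (1 - d) by rewrite !mulr_ge0// subr_ge0 ltW.
  nra.
have h2 : rr_var d a b <= (a + b)%:R - rr_mean d a b.
  rewrite /rr_var /rr_mean natrD.
  have := ler0n R a; have := ler0n R b; set A := a%:R; set B := b%:R => B0 A0.
  have : 0 <= B * d * d by rewrite !mulr_ge0// ltW.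
  have : 0 <= A * (1 - d) * (1 - d) by rewrite !mulr_ge0// subr_ge0 ltW.
  nra.
have vt : K <= rr_var d a b * tau.
  rewrite -(ler_pM2r t0) -mulrA -expr2 [X in _ <= X]mulrC tv; lra.
have g1 := ler_wpM2r (ltW t0) h1; have g2 := ler_wpM2r (ltW t0) h2.
by rewrite add0r; lra.
Qed.

Lemma rr_gf_second_moment d a b : 0 < d < 1 -> (0 < a + b)%N ->
  \sum_(j < (a + b).+1) x_ d a b j ^+ 2 * (rr_gf d a b)`_j <= 1.
Proof.
move=> d01 ab; have v0 := rr_var_gt0 d01 ab.
rewrite -(rr_prec_sqr v0) /rr_var -rr_gf_variance big_distrr/= le_eqVlt.
apply/orP; left; apply/eqP; apply: eq_bigr => j _.
rewrite /standardize; ring.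
Qed.

Lemma rr_prec_small (d : nat -> R) (a b : nat -> nat) c :
  rr_var (d n) (a n) (b n) @[n --> \oo] --> +oo -> 0 < c ->
  \forall n \near \oo, rr_prec (d n) (a n) (b n) <= c.
Proof.
move=> /cvgryPge /(_ (c ^- 2)) + c0; apply: filterS => n hn.
have v0 : 0 < rr_var (d n) (a n) (b n).
  by apply: lt_le_trans hn; rewrite invr_gt0 exprn_gt0.
rewrite invf_ple ?posrE ?sqrtr_gt0//; apply: le_trans (ler_wsqrtr hn).
by rewrite -exprVn sqrtr_sqr ler_norm.
Qed.

(* [A1], [A2], [A3], [A4], [A5] stand for [Phi] at [t - eps], [t + eps + tau],
   [t], [K] and [1 - K]. *)
Lemma cdf_error_le (A1 A2 A3 A4 A5 F lam k e : R) :
  A3 <= 1 -> 0 <= A2 -> 0 <= A3 -> A4 <= 1 -> A1 <= 1 -> 0 <= A5 ->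
  0 <= k -> k <= e -> 1 - e / 2 <= A4 -> A5 <= e / 2 ->
  0 <= F -> F <= 1 -> 0 <= lam -> lam <= 1 + e -> 0 <= e -> e <= 1 ->
  `|A2 - A3| <= e -> `|A1 - A3| <= e ->
  (F - k) * (A4 - A5) <= lam * A2 -> (1 - k) * (A1 - A5) <= lam * F ->
  `|F - A3| <= 5 * e.
Proof.
move=> A31 A20 A30 A41 A11 A50 k0 ke A4e A5e F0 F1 l0 le e0 e1.
rewrite !ler_norml => /andP[_ a2] /andP[a1 _] up lo.
have p1 : lam * A2 <= (1 + e) * (A3 + e) by apply: ler_pM => //; lra.
have p2 : e * A3 <= e by rewrite ler_piMr.
have p3 : e * e <= e by rewrite ler_piMr.
have p4 : k * (A1 - A5) <= k by rewrite ler_piMr//; lra.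
have p5 : lam * F <= (1 + e) * F by rewrite ler_wpM2r.
have p6 : e * F <= e by rewrite ler_piMr.
have p7 : F * (1 - (A4 - A5)) <= F * e by rewrite ler_wpM2l//; lra.
have p8 : k * (A4 - A5) <= k by rewrite ler_piMr//; lra.
by clear -up lo p1 p2 p3 p4 p5 p6 p7 p8 ke A5e a1; apply/andP; split; lra.
Qed.

Lemma rr_cdf_cvg (d : nat -> R) (a b : nat -> nat) (X : nat -> nat -> R) t :
  (\forall n \near \oo, 0 < d n < 1) ->
  rr_var (d n) (a n) (b n) @[n --> \oo] --> +oo ->
  (forall K eps, 1 <= K -> 0 < eps -> \forall n \near \oo,
    forall j, (j <= a n + b n)%N -> `|x_ (d n) (a n) (b n) j| <= K ->
      `|X n j - x_ (d n) (a n) (b n) j| <= eps) ->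
  {for t, continuous (Phi : R -> R)} ->
  \sum_(j < (a n + b n).+1 | X n j <= t) (rr_gf (d n) (a n) (b n))`_j @[n --> \oo]
    --> Phi t.
Proof.
move=> d01 vy HX ct.
have tau_small c : 0 < c -> \forall n \near \oo, rr_prec (d n) (a n) (b n) <= c.
  by move=> c0; exact: rr_prec_small.
apply/cvgrPdist_le => e e0.
(* [5] is the loss in [cdf_error_le], which also requires an error at most 1. Then [K] is fixed by
   the tails, [eps] by continuity at [t], and [n] last. *)
pose e' := Num.min (e / 5) 1.
have e'0 : 0 < e' by rewrite lt_min ltr01 andbT divr_gt0.
have e'1 : e' <= 1 by rewrite ge_min lexx orbT.
have e'e : 5 * e' <= e.
  by rewrite mulrC -ler_pdivlMr// ge_min lexx.
have [K [K1 tK Kinv PhiK PhiNK]] : exists K, [/\ 1 <= K, t <= K, K ^- 2 <= e',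
    1 - e' / 2 <= Phi K & Phi (1 - K) <= e' / 2].
  have e'2 : 0 < e' / 2 by rewrite divr_gt0.
  suff : \forall K \near +oo, [/\ 1 <= K, t <= K, K ^- 2 <= e',
    1 - e' / 2 <= Phi K & Phi (1 - K) <= e' / 2].
    by move=> /filter_ex.
  near=> K; have K1 : 1 <= K by near: K; exact: nbhs_pinfty_ge.
  have tK : t <= K by near: K; apply: nbhs_pinfty_ge; exact: num_real.
  have K0 : 0 < K by lra.
  split => //.
  - have K2 : e'^-1 <= K by near: K; apply: nbhs_pinfty_ge; exact: num_real.
    rewrite invf_ple ?posrE ?exprn_gt0// (le_trans K2)//.
    by rewrite expr2 ler_peMl// ltW.
  - near: K; have := @cvg_Phi_pinfty R => /cvgrPdist_le /(_ _ e'2).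
    apply: filterS => K; rewrite ler_norml => /andP[_]; lra.
  - near: K; have := @cvg_Phi_ninfty R => /cvgrPdist_le /(_ _ e'2) [M [Mr HM]].
    exists (1 - M); split=> [|K MK]; first exact: num_real.
    have := HM (1 - K); rewrite ler_norml sub0r => /(_ ltac:(lra))/andP[]; lra.
(* The radius [2 * eps] leaves room for the overshoot of one cell, since eventually [tau <= eps]. *)
have [eps eps0 Heps] : exists2 eps, 0 < eps & forall y, `|y - t| <= 2 * eps ->
    `|Phi y - Phi t| <= e'.
  move: ct => /cvgrPdist_le/(_ _ e'0)/nbhs_ballP[r/= r0 Hr].
  exists (r / 3); first by rewrite divr_gt0.
  move=> y yt; rewrite distrC; apply: Hr; rewrite /ball/= distrC.
  by apply: le_lt_trans yt _; lra.
have K0 : 0 < K by lra.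
pose C := 6 * K ^+ 3 + 4 * K.
have lamn : \forall n \near \oo, expR (C * rr_prec (d n) (a n) (b n)) <= 1 + e'.
  have C0 : 0 < C by rewrite addr_gt0 ?mulr_gt0 ?exprn_gt0.
  have l0 : 0 < ln (1 + e') by rewrite ln_gt0// ltrDl.
  near=> n; have h : rr_prec (d n) (a n) (b n) <= ln (1 + e') / C.
    by near: n; apply: tau_small; rewrite divr_gt0.
  by rewrite -ler_ln ?posrE ?expR_gt0 ?addr_gt0// expRK mulrC -ler_pdivlMr.
near=> n.
have dn : 0 < d n < 1 by near: n.
have Xn j : (j <= a n + b n)%N -> `|x_ (d n) (a n) (b n) j| <= K ->
      `|X n j - x_ (d n) (a n) (b n) j| <= eps.
  move: j; near: n; exact: HX.
have lam_le : expR (C * rr_prec (d n) (a n) (b n)) <= 1 + e' by near: n.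
have ab : (0 < a n + b n)%N.
  have : 0 < rr_var (d n) (a n) (b n).
    by near: n; move/cvgryPgt : vy; exact.
  by rewrite lt0n; apply: contraTN => /eqP E; rewrite /rr_var E mul0r ltxx.
have Kt : K * rr_prec (d n) (a n) (b n) <= 2^-1.
  rewrite mulrC -ler_pdivlMr//; near: n; apply: tau_small.
  by rewrite divr_gt0.
have te : rr_prec (d n) (a n) (b n) <= eps by near: n; exact: tau_small.
have v0 := rr_var_gt0 dn ab; have t0 := rr_prec_gt0 v0.
have t1 : rr_prec (d n) (a n) (b n) <= 1 by nra.
have [x0 xN] := rr_window dn ab Kt.
have p0 j : 0 <= (rr_gf (d n) (a n) (b n))`_j by exact: coef_rr_gf_ge0.
have [] := cdf_window t p0 (sum_coef_rr_gf _ _ _)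
  (rr_gf_second_moment dn ab) t0 t1 K1 (expR_ge0 _) x0 xN
  (rr_gf_compare dn ab K1 Kt) Xn.
rewrite -/C; set lam := expR _ in lam_le *; set F := \sum_(_ < _ | _) _ => up lo.
have F0 : 0 <= F by exact: sumr_ge0.
have F1 : F <= 1.
  rewrite -(sum_coef_rr_gf (d n) (a n) (b n)).
  by rewrite [leRHS](bigID (fun j : 'I_(a n + b n).+1 => X n j <= t))/= lerDl sumr_ge0.
have lam0 : 0 <= lam by exact: expR_ge0.
have te2 : eps + rr_prec (d n) (a n) (b n) <= 2 * eps by rewrite mulr2n mulrDl !mul1r lerD2l.
have P1 : `|Phi (t + eps + rr_prec (d n) (a n) (b n)) - Phi t| <= e'.
  apply: Heps; rewrite -(addrA t) addrAC subrr add0r ger0_norm//.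
  by rewrite addr_ge0// ltW.
have P2 : `|Phi (t - eps) - Phi t| <= e'.
  by apply: Heps; rewrite addrAC subrr sub0r normrN gtr0_norm// ler_peMl ?ler1n ?ltW.
have tK' : t - eps <= K by rewrite lerBlDr (le_trans tK)// lerDl ltW.
have k0 : 0 <= K ^- 2 by rewrite invr_ge0 exprn_ge0// ltW.
rewrite distrC; apply: le_trans e'e.
exact: (cdf_error_le (Phi_le1 t) (Phi_ge0 _) (Phi_ge0 _) (Phi_le1 _) (Phi_le1 _)
  (Phi_ge0 _) k0 Kinv PhiK PhiNK F0 F1 lam0 lam_le (ltW e'0) e'1 P1 P2 up (lo tK')).
Unshelve. all: by end_near. Qed.
End rr_limit.

(** * The log-likelihood ratio near the mean *)

Section llr.
Context {R : realType}.
Implicit Types (d K : R) (a k : nat).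

Local Notation x_ d a b := (standardize (rr_mean d a b) (rr_prec d a b)).

Lemma ln1D_bounds (z : R) : `|z| <= 2^-1 -> `|ln (1 + z) - z| <= 2 * z ^+ 2.
Proof.
rewrite ler_norml => /andP[zl zu].
have z1 : 0 < 1 + z by lra.
have h1 := expR_sub_sqr zl; have h2 := expR_ge1Dx z.
have h3 : z - 2 * z ^+ 2 <= ln (1 + z).
  by rewrite -[leLHS]expRK ler_ln ?posrE// expR_gt0.
have h4 : ln (1 + z) <= z.
  by rewrite -[leRHS]expRK ler_ln ?posrE// expR_gt0.
have := sqr_ge0 z; rewrite ler_norml => z2; apply/andP; split; lra.
Qed.

Lemma ln_ratio_bounds d (eta k : R) : 0 < d < 1 -> `|eta| <= 2 * k -> k <= 8^-1 ->
  `|ln ((1 + (1 - d) * eta) / (1 + d * eta)) - (1 - 2 * d) * eta| <= 8 * k ^+ 2.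
Proof.
move=> /andP[d0 d1] he k8.
have e2 : eta ^+ 2 <= (2 * k) ^+ 2.
  rewrite -(real_normK (num_real eta)) ler_pXn2r ?nnegrE ?normr_ge0//.
  exact: le_trans he.
have small c : 0 < c -> c < 1 -> `|c * eta| <= 2^-1.
  move=> c0 c1; rewrite normrM (ger0_norm (ltW c0)).
  have := normr_ge0 eta; nra.
have h2 := small d d0 d1.
have h1 : `|(1 - d) * eta| <= 2^-1 by apply: small; lra.
have p1 : 0 < 1 + (1 - d) * eta by move: h1; rewrite ler_norml => /andP[]; lra.
have p2 : 0 < 1 + d * eta by move: h2; rewrite ler_norml => /andP[]; lra.
rewrite ln_div ?posrE//.
have := ln1D_bounds h1; have := ln1D_bounds h2.
have e0 : 0 <= eta ^+ 2 by exact: sqr_ge0.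
(* The two logarithmic errors add up to [2 * eta ^+ 2 * ((1 - d) ^+ 2 + d ^+ 2)], hence to at most
   [2 * eta ^+ 2 <= 8 * k ^+ 2]. *)
have dd : 0 <= d * (1 - d) * eta ^+ 2.
  by rewrite mulr_ge0// mulr_ge0 ?subr_ge0 ?(ltW d0) ?(ltW d1).
rewrite !ler_norml => /andP[g1 g2] /andP[g3 g4].
clear -e2 dd g1 g2 g3 g4; apply/andP; split; lra.
Qed.

(** [U] is the deviation over the variance and [V] the gap between the two ratio bounds. They
    confine [eta] between [U - V] and [U / (1 - U) <= U + 2 * U ^+ 2], while [U] is within
    [2 * k ^+ 2] of [y]. *)
Lemma llr_increment_bounds (U V nu tau d y k eta : R) :
  0 < d < 1 -> 0 < tau -> tau <= k -> k <= 8^-1 -> 0 <= nu <= 1 -> 1 - nu <= tau ^+ 2 ->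
  V = tau ^+ 2 * nu -> U = (y + d * tau ^+ 2) * nu -> `|y| <= k ->
  (1 - U) * (1 + eta) <= 1 -> 1 + U - V <= 1 + eta ->
  `|eta| <= 2 * k /\ `|eta - y| <= 7 * k ^+ 2.
Proof.
move=> /andP[d0 d1] t0 tk k8 /andP[nu0 nu1] hnu VT UT yk r1 r2.
have k0 : 0 < k by exact: lt_le_trans tk.
have tk2 : tau ^+ 2 <= k ^+ 2 by rewrite ler_pXn2r ?nnegrE ?(ltW t0) ?(ltW k0).
have tau2 : 0 <= tau ^+ 2 by exact: sqr_ge0.
have k2 : k ^+ 2 <= k / 8 by rewrite expr2 ler_wpM2l// ltW.
have Uy : `|U - y| <= 2 * k ^+ 2.
  have -> : U - y = d * tau ^+ 2 * nu - y * (1 - nu) by rewrite UT; ring.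
  apply: (le_trans (ler_normB _ _)); rewrite mulr2n mulrDl !mul1r; apply: lerD.
    rewrite ger0_norm; last by rewrite !mulr_ge0// ltW.
    apply: le_trans tk2; rewrite mulrAC ler_piMl// -[leRHS]mulr1 ler_pM//; exact: ltW.
  rewrite normrM (ger0_norm (_ : 0 <= 1 - nu)) ?subr_ge0//.
  rewrite (le_trans _ tk2)// -[leRHS]mul1r ler_pM ?subr_ge0//.
  by rewrite (le_trans yk)// (le_trans k8)// invf_le1// ler1n.
have V1 : V <= k ^+ 2 by rewrite VT (le_trans _ tk2)// ler_piMr.
have Uk : `|U| <= k + 2 * k ^+ 2.
  have -> : U = y + (U - y) by rewrite addrC subrK.
  by apply: (le_trans (ler_normD _ _)); exact: lerD.
have Uk' : `|U| <= 5 / 4 * k by lra.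
have U2 : U ^+ 2 <= (5 / 4 * k) ^+ 2.
  rewrite -(real_normK (num_real U)) ler_pXn2r ?nnegrE ?normr_ge0//.
  exact: le_trans Uk'.
have Usmall : U <= 2^-1 by apply: le_trans (ler_norm _) _; lra.
have e1 : eta <= U + 2 * U ^+ 2.
  have h : 0 < 1 - U by lra.
  rewrite -(ler_pM2l h); have := sqr_ge0 U => sU.
  have : 0 <= U ^+ 2 * (1 - 2 * U) by rewrite mulr_ge0//; lra.
  clear -r1; lra.
have etay : `|eta - y| <= 7 * k ^+ 2.
  move: Uy; rewrite !ler_norml => /andP[Uy1 Uy2]; clear -Uy1 Uy2 e1 r2 V1 U2.
  have := sqr_ge0 k; move=> h; apply/andP; split; lra.
split=> //; have -> : eta = y + (eta - y) by rewrite addrC subrK.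
apply: (le_trans (ler_normD _ _)); clear -etay yk k2 k0; lra.
Qed.

(** Conditioning on the one user who differs makes the likelihood ratio a function of
    [eta = w0 / w1 - 1] alone, with [w] the weights of the common users. The constant is [8] from
    [ln_ratio_bounds] plus [7] from [llr_increment_bounds]. *)
Lemma rr_llr_bound d a k K j : 0 < d < 1 -> (0 < a + k)%N -> 1 <= K ->
  K * rr_prec d a.+1 k <= 8^-1 -> (j <= a.+1 + k)%N -> `|x_ d a.+1 k j| <= K ->
  `|ln ((rr_gf d a k.+1)`_j / (rr_gf d a.+1 k)`_j)
      - (1 - 2 * d) * (x_ d a.+1 k j * rr_prec d a.+1 k)| <=
  15 * (K * rr_prec d a.+1 k) ^+ 2.
Proof.
move=> d01 ak K1 Kt jN xj; have /andP[d0 d1] := d01.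
have v0 : 0 < rr_var d a.+1 k by rewrite rr_var_gt0.
have t0 := rr_prec_gt0 v0; have tv := rr_prec_sqr v0.
have vle := rr_var_le d a.+1 k.
(* Doubling [K] puts both extreme counts strictly outside the window, so [j = i.+1] with
   [i < a + k], and [w0] and [w1] are positive. *)
have [x0 xN] : x_ d a.+1 k 0 <= - (2 * K) /\ 2 * K <= x_ d a.+1 k (a.+1 + k).
  by apply: rr_window => //; lra.
move: (xj); rewrite ler_norml => /andP[xl xu].
case: j => [|i] in jN xj xl xu *; first by exfalso; lra.
have iak : (i < a + k)%N.
  move: jN; rewrite addSn ltnS leq_eqVlt => /predU1P[iE|//].
  by move: xN; rewrite addSn -iE; lra.
have rl := rr_gf_ratio_le d01 iak; have rg := rr_gf_ratio_ge d01 iak.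
rewrite /= in rl rg; rewrite rr_gfSl rr_gfSr !coef_affine_mul.
have w10 : 0 < (rr_gf d a k)`_i.+1 by exact: coef_rr_gf_gt0.
have w00 : 0 < (rr_gf d a k)`_i by apply: coef_rr_gf_gt0; rewrite // ltnW.
move: rl rg w10 w00; set w1 := _`_i.+1; set w0 := _`_i => rl rg w10 w00.
set tau := rr_prec d a.+1 k in Kt t0 tv xj xl xu *.
pose eta := w0 / w1 - 1.
have w0E : w0 = (1 + eta) * w1 by rewrite /eta addrC subrK divfK// gt_eqF.
have -> : (d * w1 + (1 - d) * w0) / ((1 - d) * w1 + d * w0) =
    (1 + (1 - d) * eta) / (1 + d * eta).
  have -> : d * w1 + (1 - d) * w0 = (1 + (1 - d) * eta) * w1 by rewrite w0E; ring.
  have -> : (1 - d) * w1 + d * w0 = (1 + d * eta) * w1 by rewrite w0E; ring.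
  by rewrite -mulf_div divff ?mulr1// gt_eqF.
set x := standardize _ _ _ in xj xl xu *.
have xE : x = (i%:R + 1 - (rr_mean d a k + d)) * tau.
  by rewrite /x /standardize /rr_mean -(natr1 a) -natr1; congr (_ * _); ring.
have s0 : 0 < d * (1 - d) by rewrite mulr_gt0// subr_gt0.
move: tv vle v0 rl rg; rewrite /rr_var addSn /= -(natr1 (a + k).+1) -(natr1 (a + k)).
rewrite -(natr1 i).
set s := d * (1 - d) in s0 *; set N : R := (a + k)%:R.
have N0 : 1 <= N by rewrite ler1n.
move=> tv vle v0 rl rg.
have tau2 : 0 <= tau ^+ 2 by exact: sqr_ge0.
have tN : 4 <= tau ^+ 2 * (N + 1) by have := ler_wpM2l tau2 vle; rewrite tv; lra.
pose U := (i%:R + 1 - rr_mean d a k) / (s * (N + 1 + 1)).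
have N2 : 0 < N + 1 + 1 by lra.
have sN2 : 0 < s * (N + 1 + 1) by rewrite mulr_gt0.
have UE : U * (s * (N + 1 + 1)) = i%:R + 1 - rr_mean d a k by rewrite divfK ?gt_eqF.
have r1 : (1 - U) * (1 + eta) <= 1.
  rewrite -(ler_pM2r (mulr_gt0 sN2 w10)) mul1r; apply: le_trans rl.
  by rewrite w0E -UE; clear; lra.
pose V := (s * (N + 1 + 1))^-1.
have VE : V * (s * (N + 1 + 1)) = 1 by rewrite mulVf ?gt_eqF.
have r2 : 1 + U - V <= 1 + eta.
  rewrite -(ler_pM2r (mulr_gt0 sN2 w10)).
  have -> : (1 + eta) * (s * (N + 1 + 1) * w1) = s * (N + 1 + 1) * w0 by rewrite w0E; ring.
  apply: le_trans rg.
  have -> : (1 + U - V) * (s * (N + 1 + 1) * w1) =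
    (s * (N + 1 + 1) + U * (s * (N + 1 + 1)) - V * (s * (N + 1 + 1))) * w1 by ring.
  by rewrite UE VE; clear; lra.
(* Here [N] counts the common users only: [tau] refers to [N + 1] users, the ratio bounds to [N], so
   the correction is [(N + 1) / (N + 2)]. *)
pose nu := (N + 1) / (N + 1 + 1).
have nuE : nu * (N + 1 + 1) = N + 1 by rewrite divfK ?gt_eqF.
have VT : V = tau ^+ 2 * nu.
  apply: (mulIf (lt0r_neq0 sN2)); rewrite VE.
  have -> : tau ^+ 2 * nu * (s * (N + 1 + 1)) = tau ^+ 2 * s * (nu * (N + 1 + 1)) by ring.
  by rewrite nuE -[LHS]tv; ring.
(* The term [d * tau ^+ 2] arises because [x] is centred at the mean of all users, which exceeds
   that of the common users by [d]. *)
have UT : U = (x * tau + d * tau ^+ 2) * nu.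
  have -> : U = (i%:R + 1 - rr_mean d a k) * V by [].
  by rewrite VT xE; ring.
have nu01 : 0 <= nu <= 1.
  rewrite ler_pdivrMr// mul1r lerDl ler01 andbT divr_ge0 ?(ltW N2)//.
  by rewrite addr_ge0.
have hnu : 1 - nu <= tau ^+ 2.
  rewrite -(ler_pM2r N2) mulrBl nuE mul1r; clear -tN tau2; lra.
have tk : tau <= K * tau by rewrite ler_peMl// ltW.
have yk : `|x * tau| <= K * tau by rewrite normrM (gtr0_norm t0) ler_wpM2r// ltW.
have [e1 e2] := llr_increment_bounds d01 t0 tk Kt nu01 hnu VT UT yk r1 r2.
have := ln_ratio_bounds d01 e1 Kt.
set L := ln _; set y := x * tau in e2 *; set kap := K * tau in e2 * => h.
have -> : L - (1 - 2 * d) * y = L - (1 - 2 * d) * eta + (1 - 2 * d) * (eta - y) by ring.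
apply: (le_trans (ler_normD _ _)).
have d2 : `|(1 - 2 * d) * (eta - y)| <= 7 * kap ^+ 2.
  rewrite normrM -[leRHS]mul1r ler_pM ?normr_ge0// ler_norml.
  by clear -d0 d1; apply/andP; split; lra.
clear -h d2; lra.
Qed.
End llr.

(** * Laws of the shuffled transcripts *)

Local Open Scope charge_scope.
(** An atom is not negligible, so integrating the derivative over it pins down its value there. *)
Lemma Radon_Nikodym_atom (R : realType) d (T : measurableType d)
    (P Q : probability T R) (z : T) :
  measurable [set z] -> P [set z] != 0%E -> charge_of_finite_measure Q `<< P ->
  fine (('d (charge_of_finite_measure Q) '/d P) z) =
    fine (Q [set z]) / fine (P [set z]).
Proof.
move=> mz Pz0 QP.
have fQ := Radon_Nikodym_fin_num z QP.
have : Q [set z] = (('d (charge_of_finite_measure Q) '/d P) z * P [set z])%E.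
  rewrite -[LHS]/(charge_of_finite_measure Q [set z]) (Radon_Nikodym_integral QP mz).
  rewrite -integral_cst//; apply: eq_integral => y.
  by rewrite inE => ->.
move=> ->; rewrite fineM ?fin_num_measure// mulfK//.
by apply: contra Pz0 => /eqP h; rewrite -(fineK (fin_num_measure P _ mz)) h.
Qed.
Local Close Scope charge_scope.

Section transcript_law.
Context {R : realType}.
Implicit Types (eps : R) (n k j : nat).

Definition ones_mset n j : transcript := seq_mset (nseq j true ++ nseq (n - j) false).

Lemma seq_mset_ones n (y : n.-tuple bool) :
  seq_mset y = ones_mset n (count_mem true y).
Proof.
have cF : count_mem false y = (n - count_mem true y)%N.
  rewrite -[X in (X - _)%N](size_tuple y) -(count_predC (pred1 true) y) addKn.
  by apply: eq_count => -[].
apply/eq_seq_msetP/allP => -[] _; apply/eqP; rewrite count_cat !count_nseq/= ?cF;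
  by rewrite ?mul0n ?mul1n ?addn0.
Qed.

Lemma ones_mset_inj n : injective (ones_mset n).
Proof.
move=> i j /eq_seq_msetP/permP/(_ (pred1 true)).
by rewrite !count_cat !count_nseq/= !mul1n !mul0n !addn0.
Qed.

Lemma count_mem_tuple n (y : n.-tuple bool) :
  count_mem true y = (\sum_(i < n) tnth y i)%N.
Proof.
rewrite -sum1_count big_mkcond big_tuple/=.
by apply: eq_bigr => i _; case: (tnth y i).
Qed.

(** Expanding the product over users gives one term per output tuple, with exponent its number of
    ones. *)
Lemma rr_joint_pmf_gf eps n (x : n.-tuple bool) j :
  \sum_(y : n.-tuple bool | count_mem true y == j) rr_joint_pmf eps x y =
  (\prod_(i < n) ((rr_pmf eps (tnth x i) false)%:P +
                  rr_pmf eps (tnth x i) true *: 'X))`_j.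
Proof.
pose G (f : {ffun 'I_n -> bool}) := [tuple f i | i < n].
have Gbij : bijective G.
  exists (fun y : n.-tuple bool => [ffun i => tnth y i]) => [f|y].
    by apply/ffunP => i; rewrite ffunE tnth_mktuple.
  by apply: eq_from_tnth => i; rewrite tnth_mktuple ffunE.
transitivity ((\sum_(y : n.-tuple bool)
    (rr_joint_pmf eps x y)%:P * 'X^(count_mem true y))`_j).
  rewrite coef_sum big_mkcond; apply: eq_bigr => y _.
  by rewrite coefCM coefXn eq_sym; case: eqP => _; rewrite ?mulr1 ?mulr0.
congr ((polyseq _)`_j); rewrite (reindex G); last exact: onW_bij.
transitivity (\sum_(f : {ffun 'I_n -> bool})
    \prod_(i < n) ((rr_pmf eps (tnth x i) (f i))%:P * 'X^(f i))).
    apply: eq_bigr => f _; rewrite count_mem_tuple big_split/= -expr_sum rmorph_prod/=.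
  by congr (_ * 'X^_); apply: eq_bigr => i _; rewrite tnth_mktuple.
rewrite -(bigA_distr_bigA (fun i (b : bool) => (rr_pmf eps (tnth x i) b)%:P * 'X^b)).
apply: eq_bigr => i _; rewrite big_bool/= expr0 mulr1 expr1 addrC.
by rewrite -mul_polyC.
Qed.

Lemma dataset_gf eps n k : (k <= n)%N ->
  \prod_(i < n) ((rr_pmf eps (tnth (dataset n k) i) false)%:P +
                  rr_pmf eps (tnth (dataset n k) i) true *: 'X) =
  rr_gf (flip_prob eps) (n - k) k.
Proof.
move=> kn; set d := flip_prob eps.
transitivity (\prod_(0 <= i < n) (if (i < k)%N then d%:P + (1 - d) *: 'X
                                   else (1 - d)%:P + d *: 'X)).
  rewrite big_mkord; apply: eq_bigr => i _.
  by rewrite tnth_mktuple /rr_pmf; case: (i < k)%N.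
rewrite (big_cat_nat _ kn)//= mulrC /rr_gf; congr (_ * _).
  rewrite big_nat (eq_bigr (fun=> (1 - d)%:P + d *: 'X)).
    by rewrite -big_nat prodr_const_nat.
  by move=> i /andP[ki _]; rewrite ltnNge ki.
rewrite big_nat (eq_bigr (fun=> d%:P + (1 - d) *: 'X)).
  by rewrite -big_nat prodr_const_nat subn0.
by move=> i /andP[_ ->].
Qed.

Lemma rr_lawE eps n k (A : set transcript) : (k <= n)%N ->
  rr_law eps n k A = (\sum_(j < n.+1 | ones_mset n j \in A)
    (rr_gf (flip_prob eps) (n - k) k)`_j)%:E.
Proof.
move=> kn; rewrite /rr_law /= /shuffled_rr.
transitivity ((\sum_(y : n.-tuple bool) rr_joint_pmf eps (dataset n k) y *
   (ones_mset n (count_mem true y) \in A)%:R)%:E).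
  rewrite -sumEFin; apply: eq_bigr => y _.
  by rewrite diracE -EFinM -seq_mset_ones.
congr (_%:E).
have cn (y : n.-tuple bool) : (count_mem true y < n.+1)%N.
  by rewrite ltnS -[X in (_ <= X)%N](size_tuple y) count_size.
rewrite (partition_big (fun y : n.-tuple bool => Ordinal (cn y)) predT)//= [RHS]big_mkcond.
apply: eq_bigr => j _; rewrite -dataset_gf// -rr_joint_pmf_gf.
transitivity ((\sum_(y : n.-tuple bool | count_mem true y == j)
    rr_joint_pmf eps (dataset n k) y) * (ones_mset n j \in A)%:R).
  by rewrite big_distrl/=; apply: eq_big => [y|y /eqP <-].
by case: (_ \in A); rewrite ?mulr1 ?mulr0.
Qed.

Lemma rr_law_atom eps n k j : (k <= n)%N -> (j <= n)%N ->
  rr_law eps n k [set ones_mset n j] = ((rr_gf (flip_prob eps) (n - k) k)`_j)%:E.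
Proof.
move=> kn jn; rewrite rr_lawE//; congr (_%:E).
rewrite (big_pred1 (inord j : 'I_n.+1)) ?inordK// => i.
apply/idP/eqP; rewrite inE/=.
  by move/ones_mset_inj => <-; rewrite inord_val.
by move=> ->; rewrite inordK.
Qed.

(** All counts from 0 to [n] have positive mass, so a null set contains no transcript of [n]
    bits. *)
Lemma rr_law_dominates eps n k k' : 0 < flip_prob eps < 1 ->
  (k <= n)%N -> (k' <= n)%N ->
  charge_of_finite_measure (rr_law eps n k') `<< rr_law eps n k.
Proof.
move=> d01 kn kn'; apply/null_content_dominatesP => A mA.
move=> /(etrans (esym (rr_lawE eps A kn))) [A0].
apply: (etrans (rr_lawE eps A kn')).
have H := psumr_eq0P _ A0.
congr (_%:E); apply: big1 => j jA.
have p0 : 0 < (rr_gf (flip_prob eps) (n - k) k)`_j.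
  by apply: coef_rr_gf_gt0 => //; rewrite subnK// -ltnS.
by move: p0; rewrite H ?ltxx// => i _; exact: coef_rr_gf_ge0.
Qed.

Lemma llr_rr_law eps n k k' j : 0 < flip_prob eps < 1 ->
  (k <= n)%N -> (k' <= n)%N -> (j <= n)%N ->
  log_likelihood_ratio (rr_law eps n k) (rr_law eps n k') (ones_mset n j) =
  ln ((rr_gf (flip_prob eps) (n - k') k')`_j / (rr_gf (flip_prob eps) (n - k) k)`_j).
Proof.
move=> d01 kn kn' jn; rewrite /log_likelihood_ratio Radon_Nikodym_atom//.
- by rewrite !rr_law_atom.
- by rewrite rr_law_atom// eqe gt_eqF// coef_rr_gf_gt0// subnK.
- exact: rr_law_dominates.
Qed.

Lemma cdf_rr_law eps n k (f : transcript -> R) t : (k <= n)%N ->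
  cdf (transcript_rv f : {RV (rr_law eps n k) >-> R}) t =
  (\sum_(j < n.+1 | f (ones_mset n j) <= t)
    (rr_gf (flip_prob eps) (n - k) k)`_j)%:E.
Proof.
move=> kn; rewrite /cdf /distribution /= /pushforward.
rewrite rr_lawE//.
congr (_%:E); apply: eq_bigl => j.
by apply/idP/idP; rewrite inE/= in_itv.
Qed.
End transcript_law.

(** * Normal limits for statistics of the transcript, and growth of powers of [n] *)

Section asymptotics.
Context {R : realType}.

Local Notation x_ d a b := (standardize (rr_mean d a b) (rr_prec d a b)).

Lemma rr_law_cvg_normal (eps : nat -> R) (k : nat -> nat) (f : nat -> transcript -> R) :
  (\forall n \near \oo, 0 < flip_prob (eps n) < 1) ->
  (\forall n \near \oo, (k n <= n)%N) ->
  rr_var (flip_prob (eps n)) (n - k n) (k n) @[n --> \oo] --> +oo ->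
  (forall K e, 1 <= K -> 0 < e -> \forall n \near \oo, forall j, (j <= n)%N ->
    `|x_ (flip_prob (eps n)) (n - k n) (k n) j| <= K ->
    `|f n (ones_mset n j) - x_ (flip_prob (eps n)) (n - k n) (k n) j| <= e) ->
  cvg_in_distribution (P := fun n => rr_law (eps n) n (k n))
    (fun n => transcript_rv (f n)) (normal_prob 0 1).
Proof.
move=> d01 kn vy Hf t ct.
rewrite -[X in _ --> X]/(normal_prob 0 1 `]-oo, t]%classic) PhiE.
have cPhi : {for t, continuous (Phi : R -> R)}.
  by apply: fine_cvg; rewrite -PhiE; exact: ct.
apply: cvg_EFin; first by near=> n; rewrite fin_num_measure.
have := @rr_cdf_cvg R (fun n => flip_prob (eps n)) (fun n => n - k n)%N k
  (fun n j => f n (ones_mset n j)) t d01 vy.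
have nk : \forall n \near \oo, (n - k n + k n = n)%N.
  by apply: filterS kn => n; exact: subnK.
move=> /(_ _ cPhi) H; apply: cvg_trans (H _); last first.
  move=> K e K1 e0; near=> n => j; have -> : (n - k n + k n = n)%N by near: n.
  by move: j; near: n; exact: Hf.
apply: near_eq_cvg; near=> n; have En : (n - k n + k n = n)%N by near: n.
have knn : (k n <= n)%N by near: n.
by apply: (etrans _ (esym (congr1 fine (cdf_rr_law (eps n) (f n) t knn)))); rewrite En.
Unshelve. all: by end_near. Qed.

(** [sigma] covers both centrings, [1] under P and [-1] under Q. As [d <= 4^-1] gives
    [1 - 2 * d >= 2^-1], dividing by [h] at most doubles the constant [15]; the centring contributes
    at most [h / 2 <= tau]. *)
Lemma llr_statistic_bound (d K sigma : R) a k j : 0 < d <= 4^-1 -> (0 < a + k)%N ->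
  1 <= K -> K * rr_prec d a.+1 k <= 8^-1 -> (j <= a.+1 + k)%N -> `|sigma| <= 1 ->
  `|x_ d a.+1 k j| <= K ->
  let h := (1 - 2 * d) * rr_prec d a.+1 k in
  `|(ln ((rr_gf d a k.+1)`_j / (rr_gf d a.+1 k)`_j) + sigma * (h ^+ 2 / 2)) / h
    - x_ d a.+1 k j| <= (30 * K ^+ 2 + 1) * rr_prec d a.+1 k.
Proof.
move=> /andP[d0 d4] ak K1 Kt jN s1 xK /=; set h := (1 - 2 * d) * _.
have d01 : 0 < d < 1 by apply/andP; split; lra.
have := rr_llr_bound d01 ak K1 Kt jN xK; rewrite -/h.
have t0 : 0 < rr_prec d a.+1 k by rewrite rr_prec_gt0// rr_var_gt0.
set L := ln _; set x := standardize _ _ _; move: (rr_prec d a.+1 k) t0 @h => tau t0 h HL.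
have D2 : 2^-1 <= 1 - 2 * d by lra.
have D1 : 1 - 2 * d <= 1 by lra.
have h0 : 0 < h by rewrite mulr_gt0//; lra.
have -> : (L + sigma * (h ^+ 2 / 2)) / h - x =
    (L - (1 - 2 * d) * (x * tau)) / h + sigma * (h / 2).
  have -> : (1 - 2 * d) * (x * tau) = x * h by rewrite /h; ring.
  by field; rewrite gt_eqF.
apply: (le_trans (ler_normD _ _)); rewrite [leRHS]mulrDl mul1r; apply: lerD.
  rewrite normrM normfV (gtr0_norm h0) ler_pdivrMr// (le_trans HL)//.
  have -> : 30 * K ^+ 2 * tau * h = 30 * (K * tau) ^+ 2 * (1 - 2 * d) by rewrite /h; ring.
  have := sqr_ge0 (K * tau); nra.
rewrite normrM (ger0_norm (_ : 0 <= h / 2)); last by rewrite divr_ge0// ltW.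
rewrite -[leRHS]mul1r ler_pM//; first by rewrite divr_ge0// ltW.
by rewrite /h; nra.
Qed.

Lemma powR_nat_near_ge (b A : R) : 0 < b -> \forall n \near \oo, A <= n%:R `^ b.
Proof.
move=> b0; near=> n; have [A0|A0] := leP A 0; first exact: le_trans (powR_ge0 _ _).
have -> : A = (A `^ b^-1) `^ b by rewrite -powRrM mulVf ?gt_eqF// powRr1// ltW.
apply: ge0_ler_powR; rewrite ?nnegrE ?powR_ge0 ?(ltW b0)//.
by near: n; exact: nbhs_infty_ger.
Unshelve. all: by end_near. Qed.
End asymptotics.

Theorem proposition6p2 (R : realType) (alpha p : R) (eps0 : nat -> R)
    (k : nat -> nat)
    (halpha : 0 < alpha < 1)
    (heps0 : forall n, (2 <= n)%N -> expR (eps0 n) = n%:R `^ alpha)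
    (hk : forall n, (2 <= n)%N -> (k n < n)%N)
    (hp : 0 <= p <= 1)
    (hkp : (k n)%:R / n%:R @[n --> \oo] --> p) :
  let P := fun n => rr_law (eps0 n) n (k n) in
  let Q := fun n => rr_law (eps0 n) n (k n).+1 in
  let Lambda := fun n => log_likelihood_ratio (P n) (Q n) in
  let delta := fun n : nat => (1 + n%:R `^ alpha)^-1 : R in
  let v := fun n : nat => n%:R * delta n * (1 - delta n) in
  let Delta := fun n : nat => 1 - 2 * delta n : R in
  let h := fun n : nat => Delta n / Num.sqrt (v n) : R in
  [/\ (h : nat -> R^o) ~_\oo (fun n => n%:R `^ ((alpha - 1) / 2)),
      h n @[n --> \oo] --> (0 : R),
      cvg_in_distribution (P := P)
        (fun n => transcript_rv (fun z => (Lambda n z + h n ^+ 2 / 2) / h n))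
        (normal_prob 0 1)
    & cvg_in_distribution (P := Q)
        (fun n => transcript_rv (fun z => (Lambda n z - h n ^+ 2 / 2) / h n))
        (normal_prob 0 1)].
Proof.
move=> P Q Lambda delta v Delta h.
have /andP[al0 al1] := halpha.
have fpE n : (2 <= n)%N -> flip_prob (eps0 n) = delta n.
  by move=> n2; rewrite /flip_prob heps0.
(* Since [n = X n / g n ^+ 2], both [v] and [h] become rational in [X] and [g]; in particular
   [h = g * (1 - X^-1)] exactly. *)
pose X n : R := n%:R `^ alpha; pose g n : R := n%:R `^ ((alpha - 1) / 2).
have b0 : 0 < (1 - alpha) / 2 by rewrite divr_gt0// subr_gt0.
have gE n : g n = (n%:R `^ ((1 - alpha) / 2))^-1.
  by rewrite -powRN; congr (_ `^ _); rewrite -mulNr opprB.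
have nX A : \forall n \near \oo, A <= X n by exact: powR_nat_near_ge.
have n2 : \forall n \near \oo, (2 <= n)%N by exact: nbhs_infty_ge.
have g0 n : (2 <= n)%N -> 0 < g n.
  by move=> n2'; rewrite powR_gt0// ltr0n (leq_trans _ n2').
have X0 n : (2 <= n)%N -> 0 < X n.
  by move=> n2'; rewrite powR_gt0// ltr0n (leq_trans _ n2').
have g2 n : (2 <= n)%N -> g n ^+ 2 * n%:R = X n.
  move=> n2'; have nn0 : (n%:R : R) != 0 by rewrite pnatr_eq0 -lt0n (leq_trans _ n2').
  rewrite /g -powR_mulrn ?powR_ge0// -powRrM divfK ?pnatr_eq0//.
  by rewrite mulrC mulr_powRB1.
have vE n : (2 <= n)%N -> v n = (X n / ((1 + X n) * g n)) ^+ 2.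
  move=> n2'; rewrite /v /delta -/(X n).
  have Xn := X0 n n2'; have gn := g0 n n2'.
  have -> : (n%:R : R) = X n / g n ^+ 2.
    by rewrite -(g2 n n2') mulrAC divff ?mul1r// gt_eqF ?exprn_gt0.
  by field; rewrite !gt_eqF ?addr_gt0.
have hE n : (2 <= n)%N -> h n = g n * (1 - (X n)^-1).
  move=> n2'; rewrite /h vE// /Delta /delta -/(X n).
  have Xn := X0 n n2'; have gn := g0 n n2'.
  rewrite sqrtr_sqr gtr0_norm ?divr_gt0 ?mulr_gt0 ?addr_gt0//.
  by field; rewrite !gt_eqF ?addr_gt0.
have g_small e : 0 < e -> \forall n \near \oo, g n <= e.
  move=> e0; near=> n; rewrite gE invf_ple ?posrE//; last first.
    by rewrite powR_gt0// ltr0n; near: n; exact: nbhs_infty_ge.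
  by near: n; exact: powR_nat_near_ge.
have vy : v n @[n --> \oo] --> +oo.
  apply/cvgryPge => A; near=> n.
  have n2' : (2 <= n)%N by near: n.
  have Xn1 : 1 <= X n by near: n.
  have gn := g0 n n2'; have Xn := X0 n n2'.
  (* With [X n >= 1], [v n] is at least [(g n)^-1 ^+ 2 / 4], hence at least [(g n)^-1 / 4] once
     [(g n)^-1 >= 1]. *)
  have hA : Num.max 1 (4 * A) <= (g n)^-1.
    by rewrite gE invrK; near: n; exact: powR_nat_near_ge.
  move: hA; rewrite ge_max => /andP[g1 gA].
  have Xg : (g n)^-1 / 2 <= X n / ((1 + X n) * g n).
    rewrite invfM mulrA [leRHS]mulrC ler_wpM2l ?invr_ge0 ?(ltW gn)//.
    rewrite ler_pdivlMr ?addr_gt0//; lra.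
  rewrite vE//; have : ((g n)^-1 / 2) ^+ 2 <= (X n / ((1 + X n) * g n)) ^+ 2.
    rewrite ler_pXn2r ?nnegrE// ?divr_ge0 ?mulr_ge0 ?invr_ge0 ?addr_ge0 ?(ltW gn) ?(ltW Xn)//.
  apply: le_trans; nra.
have d_le n : (2 <= n)%N -> 3 <= X n -> 0 < flip_prob (eps0 n) <= 4^-1.
  move=> n2' X3; rewrite fpE// /delta -/(X n) invr_gt0 addr_gt0 ?X0//=.
  by rewrite lef_pV2 ?posrE ?addr_gt0 ?X0//; lra.
have varE n : (2 <= n)%N -> rr_var (flip_prob (eps0 n)) (n - k n) (k n) = v n.
  by move=> n2'; rewrite /rr_var subnK ?fpE ?mulrA// ltnW// hk.
have varE' n : (2 <= n)%N ->
    rr_var (flip_prob (eps0 n)) (n - (k n).+1) (k n).+1 = v n.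
  by move=> n2'; rewrite /rr_var subnK ?fpE ?mulrA// hk.
have vyP : rr_var (flip_prob (eps0 n)) (n - k n) (k n) @[n --> \oo] --> +oo.
  apply: cvg_trans vy; apply: near_eq_cvg; near=> n; rewrite varE//; near: n; exact: n2.
have vyQ : rr_var (flip_prob (eps0 n)) (n - (k n).+1) (k n).+1 @[n --> \oo] --> +oo.
  apply: cvg_trans vy; apply: near_eq_cvg; near=> n; rewrite varE'//; near: n; exact: n2.
have tau_small := fun c c0 => @rr_prec_small R (fun n => flip_prob (eps0 n))
  (fun n => n - k n)%N k c vyP c0.
have d01 : \forall n \near \oo, 0 < flip_prob (eps0 n) < 1.
  near=> n; have /andP[-> dle] : 0 < flip_prob (eps0 n) <= 4^-1.
    by apply: d_le; near: n.
  by apply: le_lt_trans dle _; lra.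
have stat sigma (K e : R) : `|sigma| <= 1 -> 1 <= K -> 0 < e ->
    \forall n \near \oo, forall j, (j <= n)%N ->
    `|standardize (rr_mean (flip_prob (eps0 n)) (n - k n) (k n))
       (rr_prec (flip_prob (eps0 n)) (n - k n) (k n)) j| <= K ->
    `|(Lambda n (ones_mset n j) + sigma * (h n ^+ 2 / 2)) / h n -
      standardize (rr_mean (flip_prob (eps0 n)) (n - k n) (k n))
       (rr_prec (flip_prob (eps0 n)) (n - k n) (k n)) j| <= e.
  move=> s1 K1 e0; have K0 : 0 < K by lra.
  have C0 : 0 < 30 * K ^+ 2 + 1 by rewrite addr_gt0// mulr_gt0// exprn_gt0.
  near=> n => j jn.
  have n2' : (2 <= n)%N by near: n.
  have d4 : 0 < flip_prob (eps0 n) <= 4^-1 by apply: d_le; near: n.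
  have kn := hk n n2'.
  have Kt : K * rr_prec (flip_prob (eps0 n)) (n - k n) (k n) <= 8^-1.
    rewrite mulrC -ler_pdivlMr//; near: n; apply: tau_small; rewrite divr_gt0//.
  have et : (30 * K ^+ 2 + 1) * rr_prec (flip_prob (eps0 n)) (n - k n) (k n) <= e.
    rewrite mulrC -ler_pdivlMr//; near: n; apply: tau_small; rewrite divr_gt0//.
  have hn : h n = (1 - 2 * flip_prob (eps0 n)) *
      rr_prec (flip_prob (eps0 n)) (n - k n) (k n).
    by rewrite /rr_prec varE// fpE.
  rewrite /Lambda llr_rr_law//; first last.
  - exact: ltnW.
  - by near: n.
  have an : (n - k n = (n - (k n).+1).+1)%N by rewrite subnSK.
  rewrite hn an in Kt et * => xK.
  apply: le_trans et; apply: llr_statistic_bound => //.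
  - by rewrite addnC -ltnS -addnS -an subnKC// ltnW.
  - by rewrite -an subnK// ltnW.
split.
- apply/eqaddoP => e e0; near=> n.
  have n2' : (2 <= n)%N by near: n.
  have gn := g0 n n2'; have Xn := X0 n n2'.
  rewrite -[X in `|X|]/(h n - g n) hE// mulrBr mulr1 addrAC subrr sub0r normrN.
  rewrite normrM mulrC ler_wpM2r// ger0_norm ?invr_ge0 ?(ltW Xn)//.
  by rewrite invf_ple ?posrE//; near: n; exact: nX.
- apply/cvgrPdist_le => e e0; near=> n.
  have n2' : (2 <= n)%N by near: n.
  have gn := g0 n n2'; have Xn := X0 n n2'.
  have X1 : 1 <= X n by near: n.
  rewrite sub0r normrN hE// ger0_norm; last first.
    by rewrite mulr_ge0 ?(ltW gn)// subr_ge0 invf_le1.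
  apply: (@le_trans _ _ (g n)); last by near: n; exact: g_small.
  by rewrite ler_piMr ?(ltW gn)// gerBl invr_ge0 ltW.
- apply: rr_law_cvg_normal => //.
    by apply: filterS n2 => n /hk/ltnW.
  move=> K e K1 e0; have := stat 1 K e; rewrite normr1 => /(_ (lexx _) K1 e0).
  by apply: filterS => n H j jn xK; rewrite -[_ / 2]mul1r; exact: H.
- apply: rr_law_cvg_normal => //.
    by apply: filterS n2 => n /hk.
  move=> K e K1 e0.
  (* Under Q the count is centred at a mean larger by [1 - 2 * d]. In standardized units this shift
     is at most [tau], so it is absorbed by widening the window by 1 and by half of the error
     [e]. *)
  have K2 : 1 <= K + 1 by lra.
  have e2 : 0 < e / 2 by rewrite divr_gt0.
  have := stat (-1) (K + 1) (e / 2); rewrite normrN normr1 => /(_ (lexx _) K2 e2) st.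
  near=> n => j jn.
  have n2' : (2 <= n)%N by near: n.
  have kn := hk n n2'.
  have d4 : 0 < flip_prob (eps0 n) <= 4^-1 by apply: d_le; near: n.
  have t1 : rr_prec (flip_prob (eps0 n)) (n - k n) (k n) <= Num.min 1 (e / 2).
    by near: n; apply: tau_small; rewrite lt_min ltr01.
  move: t1; rewrite le_min => /andP[t1 te].
  have stn : `|standardize (rr_mean (flip_prob (eps0 n)) (n - k n) (k n))
       (rr_prec (flip_prob (eps0 n)) (n - k n) (k n)) j| <= K + 1 ->
    `|(Lambda n (ones_mset n j) + -1 * (h n ^+ 2 / 2)) / h n -
      standardize (rr_mean (flip_prob (eps0 n)) (n - k n) (k n))
       (rr_prec (flip_prob (eps0 n)) (n - k n) (k n)) j| <= e / 2.
    by move: j jn; near: n; exact: st.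
  have pE : rr_prec (flip_prob (eps0 n)) (n - (k n).+1) (k n).+1 =
    rr_prec (flip_prob (eps0 n)) (n - k n) (k n) by rewrite /rr_prec varE// varE'.
  rewrite pE; move: stn t1 te; rewrite mulN1r.
  have t0 : 0 < rr_prec (flip_prob (eps0 n)) (n - k n) (k n).
    rewrite rr_prec_gt0// rr_var_gt0//; first by near: n.
    by rewrite subnK ?(ltnW kn)// (leq_trans _ n2').
  move: (rr_prec _ _ _) t0 => tau t0 stn t1 te.
  set xP := standardize _ tau j in stn *.
  have -> : standardize (rr_mean (flip_prob (eps0 n)) (n - (k n).+1) (k n).+1) tau j =
      xP - (1 - 2 * flip_prob (eps0 n)) * tau.
    have an : (n - k n = (n - (k n).+1).+1)%N by rewrite subnSK.
    rewrite /xP /standardize /rr_mean an.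
    by rewrite -!natr1; ring.
  move=> xK.
  have dt : `|(1 - 2 * flip_prob (eps0 n)) * tau| <= tau.
    rewrite normrM (gtr0_norm t0) ler_piMl ?(ltW t0)// ler_norml.
    by move: d4 => /andP[? ?]; apply/andP; split; lra.
  move: (_ * tau) dt xK => D dt xK.
  have xK' : `|xP| <= K + 1.
    rewrite -[xP](subrK D) (le_trans (ler_normD _ _))// lerD//; exact: le_trans t1.
  rewrite opprD opprK addrA (le_trans (ler_normD _ _))//.
  by rewrite [leRHS]splitr lerD ?stn// (le_trans dt).
Unshelve. all: by end_near. Qed.
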